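(* Let $\mathcal{N}$ be any model of $\mathbf{ZFA}$ satisfying $\mathbf{CMC}$ together with the statement ''for every $n\in\omega$ with $n\geq 2$, $C(\omega,n)$'' and the negation of $\mathbf{IDI}$ (for instance, let $\mathcal{N}$ be Levy's Model I). Then $\mathbf{IQDI}$ holds in $\mathcal{N}$ but $\mathbf{IDI}_{F}$ fails in $\mathcal{N}$; i.e., for every $k\in\mathbb{N}$ with $k\geq 2$, $\mathbf{IDI}_{k}$ fails in $\mathcal{N}$.
   Context: $\mathbf{ZFA}$ is Zermelo-Fraenkel set theory with atoms (without the axiom of choice). $\mathbb{N}=\omega\setminus\{0\}$. A set is infinite if it is not equipotent with any $n\in\omega$, denumerable if it is equipotent with $\omega$, and Dedekind-infinite if it has a denumerable subset. $[X]^n$ is the set of all $n$-element subsets of $X$ and $[X]^{<\omega}$ the set of all finite subsets of $X$. $\mathbf{CMC}$: for every denumerable set $X$ of non-empty sets, there exists a function $f: X\to\mathcal{P}(\bigcup X)$ such that, for every $x\in X$, $f(x)$ is a non-empty finite subset of $x$. $C(\omega,n)$: every denumerable family of $n$-element sets has a choice function. $\mathbf{IDI}$: every infinite set is Dedekind-infinite. $\mathbf{IDI}_k$: for every infinite set $X$, $[X]^k$ is Dedekind-infinite. $\mathbf{IDI}_F$: for every infinite set $X$, there exists $n\in\mathbb{N}$ such that $[X]^n$ is Dedekind-infinite. $\mathbf{IQDI}$: for every infinite set $X$, $[X]^{<\omega}$ is Dedekind-infinite. Levy's Model I is the permutation model (model $\mathcal{N}6$ in Howard-Rubin's ''Consequences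 of the Axiom of Choice'') built, over a ground model of $\mathbf{ZFA}+\mathbf{AC}$, from a denumerable set of atoms $A=\bigcup_{n}A_n$, the $A_n$ pairwise disjoint with $|A_n|$ equal to the $n$-th prime, the group generated by permutations $\pi_n$ which cyclically permute $A_n$ and fix all other atoms, and finite supports. *)

(* Defs.v *)
From mathcomp Require Import all_boot.

Set Implicit Arguments.
Unset Strict Implicit.
Unset Printing Implicit Defensive.

(** * First-order structures for the language of set theory with atoms *)

Record structure : Type := Structure {
  carrier :> Type;
  elem : carrier -> carrier -> Prop;
  atom : carrier -> Prop
}.

Declare Scope zfa_scope.
Delimit Scope zfa_scope with zfa.
Notation "x ∈ y" := (elem x y) (at level 70, no associativity) : zfa_scope.
Local Open Scope zfa_scope.

(** Formulas, with de Bruijn indices; only the axiom schemes need them. *)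
Inductive formula : Type :=
| FEq (i j : nat)
| FMem (i j : nat)
| FAtom (i : nat)
| FNot (p : formula)
| FAnd (p q : formula)
| FOr (p q : formula)
| FImp (p q : formula)
| FAll (p : formula)
| FEx (p : formula).

Definition env_cons (N : Type) (x : N) (e : nat -> N) (i : nat) : N :=
  if i is j.+1 then e j else x.

Fixpoint sat (N : structure) (e : nat -> N) (p : formula) : Prop :=
  match p with
  | FEq i j => e i = e j
  | FMem i j => e i ∈ e j
  | FAtom i => atom (e i)
  | FNot p => ~ sat e p
  | FAnd p q => sat e p /\ sat e q
  | FOr p q => sat e p \/ sat e q
  | FImp p q => sat e p -> sat e q
  | FAll p => forall x : N, sat (env_cons x e) p
  | FEx p => exists x : N, sat (env_cons x e) p
  end.

(** * Set-theoretic notions, interpreted in a structure *)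

Definition is_set (N : structure) (x : N) : Prop := ~ atom x.

Definition incl (N : structure) (x y : N) : Prop := forall z, z ∈ x -> z ∈ y.

Definition is_empty (N : structure) (x : N) : Prop :=
  is_set x /\ forall z, ~ z ∈ x.

Definition is_upair (N : structure) (p a b : N) : Prop :=
  is_set p /\ forall z, z ∈ p <-> z = a \/ z = b.

Definition is_opair (N : structure) (p a b : N) : Prop :=
  exists u v, [/\ is_upair u a a, is_upair v a b & is_upair p u v].

Definition is_union (N : structure) (u x : N) : Prop :=
  is_set u /\ forall z, z ∈ u <-> exists2 y, y ∈ x & z ∈ y.

Definition is_power (N : structure) (p x : N) : Prop :=
  is_set p /\ forall z, z ∈ p <-> is_set z /\ incl z x.

Definition is_succ (N : structure) (s n : N) : Prop :=
  is_set s /\ forall z, z ∈ s <-> z ∈ n \/ z = n.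

Definition inductive_set (N : structure) (w : N) : Prop :=
  [/\ is_set w,
      forall z, is_empty z -> z ∈ w
    & forall n s, n ∈ w -> is_succ s n -> s ∈ w].

(** * The theory ZFA *)

(** The atoms form a set, as in the usual presentations where that set is a
    constant of the language. *)
Record ZFA (N : structure) : Prop := {
  zfa_atoms_empty : forall a x : N, atom a -> ~ x ∈ a;
  zfa_atoms_set : exists A : N, is_set A /\ forall x, x ∈ A <-> atom x;
  zfa_empty : exists x : N, is_empty x;
  zfa_ext : forall x y : N, is_set x -> is_set y ->
    (forall z, z ∈ x <-> z ∈ y) -> x = y;
  zfa_pair : forall a b : N, exists p, is_upair p a b;
  zfa_union : forall x : N, is_set x -> exists u, is_union u x;
  zfa_power : forall x : N, is_set x -> exists p, is_power p x;
  zfa_infinity : exists w : N, inductive_set w;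
  zfa_separation : forall (p : formula) (e : nat -> N) (a : N), is_set a ->
    exists b, is_set b /\
      forall x, x ∈ b <-> x ∈ a /\ sat (env_cons x e) p;
  zfa_replacement : forall (p : formula) (e : nat -> N) (a : N), is_set a ->
    (forall x y y', x ∈ a ->
       sat (env_cons x (env_cons y e)) p ->
       sat (env_cons x (env_cons y' e)) p -> y = y') ->
    exists b, is_set b /\
      forall y, y ∈ b <->
        exists2 x, x ∈ a & sat (env_cons x (env_cons y e)) p;
  zfa_foundation : forall x : N, (exists z, z ∈ x) ->
    exists2 y, y ∈ x & forall z, z ∈ x -> ~ z ∈ y
}.

(** * Functions, natural numbers, cardinality *)

Definition maps (N : structure) (f x y : N) : Prop :=
  exists2 p, is_opair p x y & p ∈ f.

Definition is_function (N : structure) (f X Y : N) : Prop :=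
  [/\ is_set f,
      forall p, p ∈ f -> exists x y, [/\ x ∈ X, y ∈ Y & is_opair p x y]
    & forall x, x ∈ X -> exists! y, maps f x y].

Definition is_bijection (N : structure) (f X Y : N) : Prop :=
  [/\ is_function f X Y,
      forall x x' y, maps f x y -> maps f x' y -> x = x'
    & forall y, y ∈ Y -> exists x, maps f x y].

Definition equipotent (N : structure) (X Y : N) : Prop :=
  exists f, is_bijection f X Y.

Definition is_omega (N : structure) (w : N) : Prop :=
  inductive_set w /\ forall v, inductive_set v -> incl w v.

Definition in_omega (N : structure) (n : N) : Prop :=
  exists2 w, is_omega w & n ∈ w.

(** [n >= 2] for a von Neumann natural number [n]; [2] is the successor of the
    successor of the empty set and [<] is membership. *)
Definition ge2 (N : structure) (n : N) : Prop :=
  exists zero one two, [/\ is_empty zero, is_succ one zero, is_succ two one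
    & two ∈ n \/ two = n].

Definition finite_set (N : structure) (X : N) : Prop :=
  is_set X /\ exists2 n, in_omega n & equipotent X n.

Definition infinite_set (N : structure) (X : N) : Prop :=
  is_set X /\ forall n, in_omega n -> ~ equipotent X n.

Definition denumerable (N : structure) (X : N) : Prop :=
  is_set X /\ exists2 w, is_omega w & equipotent X w.

Definition dedekind_infinite (N : structure) (X : N) : Prop :=
  exists2 Y, incl Y X & denumerable Y.

(** [S] is the set [[X]^n] of the [n]-element subsets of [X]. *)
Definition is_nsubsets (N : structure) (S X n : N) : Prop :=
  is_set S /\ forall z, z ∈ S <-> [/\ is_set z, incl z X & equipotent z n].

(** [S] is the set of the finite subsets of [X]. *)
Definition is_finsubsets (N : structure) (S X : N) : Prop :=
  is_set S /\ forall z, z ∈ S <-> finite_set z /\ incl z X.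

(** * The choice principles and definitions of infinity *)

Definition CMC (N : structure) : Prop :=
  forall X : N, denumerable X ->
    (forall x, x ∈ X -> is_set x /\ exists z, z ∈ x) ->
    exists U P f, [/\ is_union U X, is_power P U, is_function f X P
      & forall x y, x ∈ X -> maps f x y ->
          [/\ finite_set y, exists z, z ∈ y & incl y x]].

(** The principle C(ω,n), for a natural number [n] of the structure. *)
Definition C_omega (N : structure) (n : N) : Prop :=
  forall X : N, denumerable X ->
    (forall x, x ∈ X -> is_set x /\ equipotent x n) ->
    exists U f, [/\ is_union U X, is_function f X U
      & forall x y, x ∈ X -> maps f x y -> y ∈ x].

Definition IDI (N : structure) : Prop :=
  forall X : N, infinite_set X -> dedekind_infinite X.

Definition IDI_k (N : structure) (k : N) : Prop :=
  forall X : N, infinite_set X ->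
    exists2 S, is_nsubsets S X k & dedekind_infinite S.

Definition IDI_F (N : structure) : Prop :=
  forall X : N, infinite_set X ->
    exists n, [/\ in_omega n, ~ is_empty n
      & exists2 S, is_nsubsets S X n & dedekind_infinite S].

Definition IQDI (N : structure) : Prop :=
  forall X : N, infinite_set X ->
    exists2 S, is_finsubsets S X & dedekind_infinite S.

(** * The cumulative hierarchy over a type of atoms

  Well-founded trees with leaves in [A], taken up to bisimilarity: with
    classical choice and extensionality in the metatheory this is a model of
    ZFA + AC whose atoms are the elements of [A]. *)

Inductive tree (A : Type) : Type :=
| Leaf (a : A)
| Node (J : Type) (f : J -> tree A).

Fixpoint tree_eq (A : Type) (s t : tree A) : Prop :=
  match s, t with
  | Leaf a, Leaf b => a = b
  | Node J f, Node K g =>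
      (forall i, exists j, tree_eq (f i) (g j)) /\
      (forall j, exists i, tree_eq (f i) (g j))
  | _, _ => False
  end.

Definition tree_mem (A : Type) (s t : tree A) : Prop :=
  if t is Node _ f then exists i, tree_eq s (f i) else False.

(** Elements are bisimilarity classes, so that equality is Leibniz equality. *)
Definition hierarchy_carrier (A : Type) : Type :=
  {C : tree A -> Prop | exists t, C = tree_eq t}.

Definition hierarchy (A : Type) : structure := {|
  carrier := hierarchy_carrier A;
  elem := fun x y => exists s t, [/\ sval x s, sval y t & tree_mem s t];
  atom := fun x => exists a, sval x (Leaf a)
|}.

Definition substructure (N : structure) (P : N -> Prop) : structure := {|
  carrier := {x : N | P x};
  elem := fun x y => sval x ∈ sval y;
  atom := fun x => atom (sval x)
|}.

(** * Permutation models with finite supports *)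

Fixpoint tree_act (A : Type) (g : A -> A) (t : tree A) : tree A :=
  match t with
  | Leaf a => Leaf (g a)
  | Node J f => Node (fun i => tree_act g (f i))
  end.

Definition tree_symmetric (A : eqType) (G : (A -> A) -> Prop) (t : tree A) :
    Prop :=
  exists E : seq A, forall g, G g -> {in E, g =1 id} ->
    tree_eq (tree_act g t) t.

Fixpoint tree_hsymmetric (A : eqType) (G : (A -> A) -> Prop) (t : tree A) :
    Prop :=
  tree_symmetric G t /\
  match t with
  | Leaf _ => True
  | Node J f => forall i, tree_hsymmetric G (f i)
  end.

Definition permutation_model (A : eqType) (G : (A -> A) -> Prop) : structure :=
  @substructure (hierarchy A)
    (fun x => exists2 t, sval x t & tree_hsymmetric G t).

Inductive generated (A : Type) (S : (A -> A) -> Prop) : (A -> A) -> Prop :=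
| generated_gen g : S g -> generated S g
| generated_id : generated S id
| generated_comp g h : generated S g -> generated S h -> generated S (g \o h)
| generated_inv g h : generated S g -> cancel g h -> cancel h g ->
    generated S h.

(** * Levy's Model I *)

Lemma next_prime_ex (m : nat) : exists p, (m < p) && prime p.
Proof. by case: (prime_above m) => p lt_mp pr_p; exists p; rewrite lt_mp. Qed.

Definition next_prime (m : nat) : nat := ex_minn (next_prime_ex m).

(** Counting from [0]: the values are 2, 3, 5, 7 and so on. *)
Definition nth_prime (n : nat) : nat := iter n next_prime 2.

(** The block [A_n] consists of the atoms with first component [n]. *)
Definition levy_atom : eqType := {n : nat & 'I_(nth_prime n)}.

(** [ordS] is the successor modulo [nth_prime n]. *)
Definition levy_perm (n : nat) (a : levy_atom) : levy_atom :=
  if tag a == n then Tagged (fun n => 'I_(nth_prime n)) (ordS (tagged a))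
  else a.

Definition levy_group : (levy_atom -> levy_atom) -> Prop :=
  generated (fun g => exists n, g = levy_perm n).

Definition levy_model : structure := permutation_model levy_group.

(* Main.v *)
Require Import Defs.
From mathcomp Require Import all_boot.
From mathcomp Require Import boolp.

(** In any model of ZFA, let X be infinite. CMC picks a non-empty finite set of
  n-element subsets of X for each n; the union of the n-th choice is a finite
  subset of X with at least n elements, so infinitely many finite subsets of X
  arise, indexed by ω: this is IQDI. If X is moreover not Dedekind-infinite,
  then neither is [X]^k, by induction on k: choose an element from each member
  of a denumerable D ⊆ [X]^(k+1); the chosen elements form a countable, hence
  finite, subset of X, so one x is chosen infinitely often, and removing x from
  those members gives a denumerable subset of [X]^k.

  The ω of the model may be nonstandard, so all of this is internal, and
  separation and replacement only apply to predicates given by formulas.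
  Definability with parameters is therefore treated as a property of predicates
  of the metatheory, and it is closed under the logical connectives.

  In Levy's model a set has finite support iff all but finitely many generators
  fix it; the generators commute and have pairwise distinct prime orders. If a
  denumerable family is fixed by the generators from the m-th on, so is each of
  its members. Hence orbits under these generators give multiple choices (they
  are finite), and on members with k elements every generator of order above k
  acts trivially, so that any external choice of elements is in the model. A
  denumerable set of atoms would lie in finitely many blocks. *)

Set Implicit Arguments.
Unset Strict Implicit.
Unset Printing Implicit Defensive.

Local Open Scope zfa_scope.

(** * Definability with parameters *)

Fixpoint rename (r : nat -> nat) (p : formula) : formula :=
  let up i := if i is j.+1 then (r j).+1 else 0 in
  match p with
  | FEq i j => FEq (r i) (r j)
  | FMem i j => FMem (r i) (r j)
  | FAtom i => FAtom (r i)
  | FNot p => FNot (rename r p)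
  | FAnd p q => FAnd (rename r p) (rename r q)
  | FOr p q => FOr (rename r p) (rename r q)
  | FImp p q => FImp (rename r p) (rename r q)
  | FAll p => FAll (rename up p)
  | FEx p => FEx (rename up p)
  end.

Section Definability.
Variable N : structure.
Implicit Types (e : nat -> N) (P Q : (nat -> N) -> Prop) (t u v : (nat -> N) -> N).

Lemma sat_rename p r e : sat e (rename r p) = sat (e \o r) p.
Proof.
have up x r' e' : env_cons x e' \o (fun i => if i is j.+1 then (r' j).+1 else 0)
   = env_cons (x : N) (e' \o r') by apply: funext; case.
elim: p r e => //= [p IH|p IHp q IHq|p IHp q IHq|p IHp q IHq|p IH|p IH] r e.
- by rewrite IH.
- by rewrite IHp IHq.
- by rewrite IHp IHq.
- by rewrite IHp IHq.
- by apply: eq_forall => x; rewrite IH up.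
- by apply: eq_exists => x; rewrite IH up.
Qed.

(* [inl i] is a variable, [inr a] a parameter. *)
Definition eval e (s : nat + N) : N :=
  match s with inl i => e i | inr a => a end.

(** The language has no function symbols, so a term is a variable or a fixed element of [N]. *)
Definition is_term t : Prop := exists s, forall e, t e = eval e s.

(** The assignment [s] lets each variable of the formula stand for a variable of the context or for
    a parameter. Equality of propositions, rather than equivalence, lets the closure properties be
    proved by rewriting. *)
Definition definable P : Prop :=
  exists p (s : nat -> nat + N), forall e, P e = sat (eval e \o s) p.

Definition definable1 (P : N -> Prop) : Prop := definable (fun e => P (e 0)).
Definition definable2 (R : N -> N -> Prop) : Prop :=
  definable (fun e => R (e 0) (e 1)).

Lemma is_term_var i : is_term (fun e => e i).
Proof. by exists (inl i). Qed.

Lemma is_term_const a : is_term (fun=> a).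
Proof. by exists (inr a). Qed.

Lemma is_term_comp t (f : nat -> nat) : is_term t ->
  is_term (fun e => t (fun i => e (f i))).
Proof.
case=> -[i|a] H; [exists (inl (f i))|exists (inr a)] => e; exact: H.
Qed.

Lemma definable_comp P (s : nat -> nat + N) :
  definable P -> definable (fun e => P (fun i => eval e (s i))).
Proof.
case=> p [s0 H]; exists p.
exists (fun i => match s0 i with inl j => s j | inr a => inr a end) => e.
by rewrite H; congr sat; apply: funext => i /=; case: (s0 i).
Qed.

Lemma definable_app1 (P : N -> Prop) t : definable1 P -> is_term t ->
  definable (fun e => P (t e)).
Proof.
move=> HP [s Hs]; have := definable_comp (fun=> s) HP.
by congr definable; apply: funext => e; rewrite Hs.
Qed.

Lemma definable_app2 (R : N -> N -> Prop) t u :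
  definable2 R -> is_term t -> is_term u -> definable (fun e => R (t e) (u e)).
Proof.
move=> HR [s Hs] [s' Hs'].
have := definable_comp (fun i => if i is 0 then s else s') HR.
by congr definable; apply: funext => e; rewrite Hs Hs'.
Qed.

Lemma definable_eq t u : is_term t -> is_term u -> definable (fun e => t e = u e).
Proof. by apply: (@definable_app2 eq); exists (FEq 0 1), inl. Qed.

Lemma definable_elem t u : is_term t -> is_term u -> definable (fun e => t e ∈ u e).
Proof. by apply: (@definable_app2 (@elem N)); exists (FMem 0 1), inl. Qed.

Lemma definable_atom t : is_term t -> definable (fun e => atom (t e)).
Proof. by apply: (@definable_app1 (@atom N)); exists (FAtom 0), inl. Qed.

Lemma definable_not P : definable P -> definable (fun e => ~ P e).
Proof. by case=> p [s H]; exists (FNot p), s => e; rewrite H. Qed.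

(* Two formulas are given common parameters by interleaving their variables. *)
Lemma definable_join P Q : definable P -> definable Q ->
  exists p q s, forall e,
    P e = sat (eval e \o s) p /\ Q e = sat (eval e \o s) q.
Proof.
case=> p [s H] [q [s' H']].
exists (rename double p), (rename (fun i => i.*2.+1) q).
exists (fun i => if odd i then s' i./2 else s i./2) => e.
rewrite !sat_rename H H'; split; congr sat; apply: funext => i /=.
  by rewrite odd_double doubleK.
by rewrite odd_double uphalf_double.
Qed.

Lemma definable_and P Q : definable P -> definable Q ->
  definable (fun e => P e /\ Q e).
Proof.
move=> HP HQ; have [p [q [s H]]] := definable_join HP HQ.
by exists (FAnd p q), s => e; case: (H e) => -> ->.
Qed.

Lemma definable_or P Q : definable P -> definable Q ->
  definable (fun e => P e \/ Q e).
Proof.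
move=> HP HQ; have [p [q [s H]]] := definable_join HP HQ.
by exists (FOr p q), s => e; case: (H e) => -> ->.
Qed.

Lemma definable_imp P Q : definable P -> definable Q ->
  definable (fun e => P e -> Q e).
Proof.
move=> HP HQ; have [p [q [s H]]] := definable_join HP HQ.
by exists (FImp p q), s => e; case: (H e) => -> ->.
Qed.

Lemma definable_and3 P Q (R : (nat -> N) -> Prop) : definable P -> definable Q ->
  definable R ->
  definable (fun e => [/\ P e, Q e & R e]).
Proof.
move=> HP HQ HR; have := definable_and HP (definable_and HQ HR).
by congr definable; apply: funext => e; rewrite and3E.
Qed.

Lemma definable_and4 P Q (R S : (nat -> N) -> Prop) : definable P ->
  definable Q -> definable R -> definable S ->
  definable (fun e => [/\ P e, Q e, R e & S e]).
Proof.
move=> HP HQ HR HS; have := definable_and HP (definable_and3 HQ HR HS).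
by congr definable; apply: funext => e; rewrite and4E and3E.
Qed.

Lemma definable_iff P Q : definable P -> definable Q ->
  definable (fun e => P e <-> Q e).
Proof. by move=> HP HQ; apply: definable_and; apply: definable_imp. Qed.

Lemma definable_bind (P : N -> (nat -> N) -> Prop) :
  definable (fun e => P (e 0) (fun i => e i.+1)) ->
  exists p (s : nat -> nat + N), forall x e,
    P x e = sat (env_cons x (eval e \o s)) p.
Proof.
case=> p [s H].
(* All variables of [p] that read the bound value are merged into index 0, and the others move up by
   one. The new assignment is arbitrary at the merged indices, where the renamed formula no longer
   reads it. *)
exists (rename (fun i => if s i is inl 0 then 0 else i.+1) p).
exists (fun i => match s i with inl j => inl j.-1 | inr a => inr a end) => x e.
rewrite sat_rename; apply: etrans (H (env_cons x e)) _.
by congr sat; apply: funext => i /=; case E: (s i) => [[|j]|a] //=; rewrite E.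
Qed.

Lemma definable_forall (P : N -> (nat -> N) -> Prop) :
  definable (fun e => P (e 0) (fun i => e i.+1)) ->
  definable (fun e => forall x, P x e).
Proof.
move=> /definable_bind[p [s H]]; exists (FAll p), s => e.
by apply: eq_forall => x; rewrite H.
Qed.

Lemma definable_exists (P : N -> (nat -> N) -> Prop) :
  definable (fun e => P (e 0) (fun i => e i.+1)) ->
  definable (fun e => exists x, P x e).
Proof.
move=> /definable_bind[p [s H]]; exists (FEx p), s => e.
by apply: eq_exists => x; rewrite H.
Qed.

Lemma definable_exists2 (P Q : N -> (nat -> N) -> Prop) :
  definable (fun e => P (e 0) (fun i => e i.+1)) ->
  definable (fun e => Q (e 0) (fun i => e i.+1)) ->
  definable (fun e => exists2 x, P x e & Q x e).
Proof.
move=> HP HQ; have := @definable_exists (fun x e =>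
    P x e /\ Q x e) (definable_and HP HQ).
congr definable; apply: funext => e; apply: propext.
by split=> [[x []]|[x]]; exists x.
Qed.

End Definability.

Ltac definable_term := solve [assumption | exact: is_term_var | exact: is_term_const
  | apply: is_term_comp; definable_term].

(** Recursion on the shape of the predicate; when no connective is visible, a layer of set-theoretic
    notions is unfolded. The annotation [carrier _] tells a quantifier over the structure from an
    implication. *)
Ltac definability_with unfold_notions := cbv beta;
  lazymatch goal with
  | |- definable1 _ => rewrite /definable1; definability_with unfold_notions
  | |- definable2 _ => rewrite /definable2; definability_with unfold_notions
  | |- is_term _ => definable_term
  | |- definable (fun e => forall x : carrier _, _) => apply: definable_forall;
      definability_with unfold_notions
  | |- definable (fun e => exists x, _) => apply: definable_exists;
      definability_with unfold_notions
  | |- definable (fun e => exists2 x, _ & _) => apply: definable_exists2;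
      definability_with unfold_notions
  | |- definable (fun e => _ /\ _) => apply: definable_and;
      definability_with unfold_notions
  | |- definable (fun e => [/\ _, _ & _]) => apply: definable_and3;
      definability_with unfold_notions
  | |- definable (fun e => [/\ _, _, _ & _]) => apply: definable_and4;
      definability_with unfold_notions
  | |- definable (fun e => _ \/ _) => apply: definable_or;
      definability_with unfold_notions
  | |- definable (fun e => _ <-> _) => apply: definable_iff;
      definability_with unfold_notions
  | |- definable (fun e => ~ _) => apply: definable_not;
      definability_with unfold_notions
  | |- definable (fun e => _ -> _) => apply: definable_imp;
      definability_with unfold_notions
  | |- definable (fun e => _ = _) => apply: definable_eq; definable_term
  | |- definable (fun e => _ ∈ _) => apply: definable_elem; definable_term
  | |- definable (fun e => atom _) => apply: definable_atom; definable_term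
  | H : definable2 ?R |- definable (fun e => ?R _ _) =>
      apply: (definable_app2 H); definable_term
  | H : definable1 ?R |- definable (fun e => ?R _) => apply: (definable_app1 H);
      definable_term
  | |- _ => unfold_notions tt; definability_with unfold_notions
  end.

Ltac definability := definability_with ltac:(fun _ => progress unfold
  is_set, incl, is_empty, is_upair, is_opair, is_union, is_power, is_succ,
  inductive_set, maps, is_function, is_bijection, equipotent, unique, is_omega,
  in_omega, finite_set, denumerable, dedekind_infinite, is_nsubsets).

(** * Elementary set theory in a model of ZFA *)

Section SetTheory.
Variable N : structure.
Hypothesis HZ : ZFA N.
Implicit Types (x y z a b d k m n s t w D F I S X Y f : N)
  (P : N -> Prop) (R : N -> N -> Prop).

Lemma set_ext x y : is_set x -> is_set y -> (forall z, z ∈ x <-> z ∈ y) -> x = y.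
Proof. exact: zfa_ext. Qed.

Lemma separation P a : definable1 P -> is_set a ->
  exists b, is_set b /\ forall x, x ∈ b <-> x ∈ a /\ P x.
Proof.
case=> p [s H] sa.
(* The predicate will be evaluated in the constant environment [x], so all context variables may be
   merged into index 0. Each parameter keeps a place of its own in [e], whose default value [a] is
   never read. *)
pose r i := if s i is inl _ then 0 else i.+1.
pose e i := if s i is inr c then c else a.
have [b [sb Hb]] := zfa_separation HZ (rename r p) e sa.
exists b; split=> // x; rewrite Hb sat_rename (H (fun=> x)).
suff -> : env_cons x e \o r = eval (fun=> x) \o s by [].
by apply: funext => i; rewrite /= /r; case E: (s i) => [j|c] //=; rewrite /e E.
Qed.

Lemma replacement R a : definable2 R -> is_set a ->
  (forall x y y', x ∈ a -> R x y -> R x y' -> y = y') ->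
  exists b, is_set b /\ forall y, y ∈ b <-> exists2 x, x ∈ a & R x y.
Proof.
case=> p [s H] sa Rfun.
pose r' i := match s i with inl 0 => 0 | inl _ => 1 | inr _ => i.+2 end.
pose e i := if s i is inr c then c else a.
have E x y : sat (env_cons x (env_cons y e)) (rename r' p) = R x y.
  rewrite sat_rename (H (fun i => if i is 0 then x else y)).
  congr sat; apply: funext => i; rewrite /= /r'.
  by case E: (s i) => [[|j]|c] //=; rewrite /e E.
have [|b [sb Hb]] := zfa_replacement HZ (p := rename r' p) (e := e) sa.
  by move=> x y y'; rewrite !E; exact: Rfun.
exists b; split=> // y; rewrite Hb.
by split=> -[x xa]; rewrite ?E => Rxy; exists x; rewrite ?E.
Qed.

(** * Ordered pairs and functions *)

Lemma upair_unique p q a b : is_upair p a b -> is_upair q a b -> p = q.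
Proof. by case=> sp Hp [sq Hq]; apply: set_ext => // z; rewrite Hp Hq. Qed.

Lemma opair_exists a b : exists p, is_opair p a b.
Proof.
have [u Hu] := zfa_pair HZ a a; have [v Hv] := zfa_pair HZ a b.
by have [p Hp] := zfa_pair HZ u v; exists p, u, v.
Qed.

Lemma opair_unique p q a b : is_opair p a b -> is_opair q a b -> p = q.
Proof.
case=> u [v [Hu Hv Hp]] [u' [v' [Hu' Hv' Hq]]].
rewrite -(upair_unique Hu Hu') -(upair_unique Hv Hv') in Hq.
exact: upair_unique Hp Hq.
Qed.

Lemma opair_inj p a b c d : is_opair p a b -> is_opair p c d -> a = c /\ b = d.
Proof.
case=> u [v [[_ Hu] [_ Hv] [_ Hp]]] [u' [v' [[_ Hu'] [_ Hv'] [_ Hp']]]].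
have Eu : u = u' \/ u = v' by apply/Hp'/Hp; left.
have Ev : v = u' \/ v = v' by apply/Hp'/Hp; right.
have Eu' : u' = u \/ u' = v by apply/Hp/Hp'; left.
have Ev' : v' = u \/ v' = v by apply/Hp/Hp'; right.
have ac : a = c.
  case: Eu => E.
    have : a ∈ u' by rewrite -E; apply/Hu; left.
    by move/Hu' => [].
  have : c ∈ u by rewrite E; apply/Hv'; left.
  by move/Hu => [].
subst c; split=> //.
have bd : b = a \/ b = d.
  have bv : b ∈ v by apply/Hv; right.
  case: Ev => E; rewrite E in bv; first by move/Hu': bv => [] ->; left.
  by move/Hv': bv.
have db : d = a \/ d = b.
  have dv' : d ∈ v' by apply/Hv'; right.
  case: Ev' => E; rewrite E in dv'; first by move/Hu: dv' => [] ->; left.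
  by move/Hv: dv'.
by case: bd db => [->|-> _ //]; case=> ->.
Qed.

Lemma empty_exists : exists x, is_empty x.
Proof. exact: zfa_empty. Qed.

(** Replacement along the map from [x] to the pair of [x] and its value gives the graph directly,
    without a Cartesian product. *)
Lemma graph_exists R X Y : definable2 R ->
  (forall x, x ∈ X -> exists2 y, y ∈ Y & R x y) ->
  (forall x y y', x ∈ X -> R x y -> R x y' -> y = y') ->
  exists f, is_function f X Y /\ forall x y, maps f x y <-> x ∈ X /\ R x y.
Proof.
move=> dR Rtot Rfun.
have [f [sf Hf]] : exists f, is_set f /\ forall p, p ∈ f <-> exists2 x,
    x ∈ X & exists2 y, R x y & is_opair p x y.
  (* Replacement needs a set; an atom has no members, so there the empty graph serves. *)
  have [aX|sX] := lem (atom X).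
    have [f [sf Hf]] := empty_exists; exists f; split=> // p; split;
        first by move/Hf.
    by case=> x /(zfa_atoms_empty HZ aX).
  apply: replacement sX _; first by definability.
  move=> x p p' xX [y Rxy pxy] [y' Rxy' pxy'].
  by rewrite (Rfun _ _ _ xX Rxy' Rxy) in pxy'; exact: opair_unique pxy pxy'.
have mapsE x y : maps f x y <-> x ∈ X /\ R x y.
  split=> [[p pxy /Hf[x' x'X [y' Rxy' pxy']]]|[xX Rxy]].
    by have [-> ->] := opair_inj pxy pxy'.
  by have [p pxy] := opair_exists x y; exists p => //; apply/Hf; exists x => //;
      exists y.
exists f; split=> //; split=> // [p /Hf[x xX [y Rxy pxy]]|x xX].
  have [y' y'Y Rxy'] := Rtot _ xX.
  by exists x, y; split=> //; rewrite (Rfun _ _ _ xX Rxy Rxy').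
have [y yY Rxy] := Rtot _ xX.
by exists y; split=> [|y' /mapsE[_]]; [apply/mapsE|apply: Rfun xX Rxy].
Qed.

(** A bijection as a relation of the metatheory, constrained on [X] and [Y] only. The last clause
    joins single-valuedness and injectivity in a form symmetric in the two sides. With definability
    it is interchangeable with [equipotent], and it is easier to build. *)
Definition bijective_between R X Y : Prop :=
  [/\ forall x, x ∈ X -> exists2 y, y ∈ Y & R x y,
      forall y, y ∈ Y -> exists2 x, x ∈ X & R x y
    & forall x x' y y', x ∈ X -> x' ∈ X -> y ∈ Y -> y' ∈ Y ->
        R x y -> R x' y' -> (x = x' <-> y = y')].

Lemma equipotentI R X Y : definable2 R -> bijective_between R X Y -> equipotent X Y.
Proof.
move=> dR [tot sur inj].
(* [R] may also relate members of [X] to objects outside [Y], where nothing makes it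
   single-valued. *)
pose R' x y := y ∈ Y /\ R x y.
have [f [Ff mapsE]] : exists f, is_function f X Y /\ forall x y,
    maps f x y <-> x ∈ X /\ R' x y.
  apply: graph_exists; rewrite /R'; first by definability.
    by move=> x /tot[y yY Rxy]; exists y.
  by move=> x y y' xX [yY Rxy] [y'Y Rxy']; apply/(inj x x).
exists f; split=> //.
  by move=> x x' y /mapsE[xX [yY Rxy]] /mapsE[x'X [_ Rx'y]]; apply/(inj x x' y y).
by move=> y yY; have [x xX Rxy] := sur _ yY; exists x; apply/mapsE.
Qed.

Lemma function_value f X Y x y : is_function f X Y -> maps f x y -> x ∈ X /\ y ∈ Y.
Proof.
case=> _ Hf _ [p pxy /Hf[x' [y' [x'X y'Y px'y']]]].
by have [-> ->] := opair_inj pxy px'y'.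
Qed.

Lemma function_fun f X Y x y y' : is_function f X Y -> maps f x y ->
  maps f x y' -> y = y'.
Proof.
move=> Ff fxy fxy'; have [xX _] := function_value Ff fxy.
by case: Ff => _ _ /(_ _ xX)[z [_ uz]]; rewrite -(uz _ fxy) -(uz _ fxy').
Qed.

Lemma function_total f X Y x : is_function f X Y -> x ∈ X ->
  exists2 y, y ∈ Y & maps f x y.
Proof.
by move=> Ff xX; have [_ _ /(_ _ xX)[y [fxy _]]] := Ff; exists y;
    case: (function_value Ff fxy).
Qed.

Lemma definable_maps f : definable2 (maps f).
Proof. by definability. Qed.

Lemma equipotentE X Y : equipotent X Y -> exists2 R,
    definable2 R & bijective_between R X Y.
Proof.
case=> f [Ff inj sur]; exists (maps f); first exact: definable_maps.
split; first by move=> x; exact: function_total.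
  by move=> y /sur[x fxy]; exists x => //; case: (function_value Ff fxy).
move=> x x' y y' _ _ _ _ fxy fx'y'; split=> E; subst.
  exact: function_fun Ff fxy fx'y'.
exact: inj fxy fx'y'.
Qed.

Lemma definable_flip R : definable2 R -> definable2 (fun x y => R y x).
Proof. by move=> dR; definability. Qed.

Lemma bijective_between_sym R X Y :
  bijective_between R X Y -> bijective_between (fun x y => R y x) Y X.
Proof.
case=> tot sur inj; split=> // y y' x x' yY y'Y xX x'X Rxy Rx'y'.
by split=> E; apply/(inj x x' y y').
Qed.

Lemma equipotent_refl X : equipotent X X.
Proof.
apply: (@equipotentI eq); first by definability.
by split=> [x xX|x xX|x x' y y' _ _ _ _ -> ->] //; exists x.
Qed.

Lemma equipotent_sym X Y : equipotent X Y -> equipotent Y X.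
Proof.
case/equipotentE=> R dR /bijective_between_sym.
by apply: equipotentI; exact: definable_flip.
Qed.

Lemma equipotent_trans X Y Z : equipotent X Y -> equipotent Y Z -> equipotent X Z.
Proof.
case/equipotentE=> R dR [tot sur inj] /equipotentE[S dS [tot' sur' inj']].
apply: (@equipotentI (fun x z => exists2 y, y ∈ Y & R x y /\ S y z));
    first by definability.
split.
- by move=> x /tot[y yY Rxy]; have [z zZ Syz] := tot' _ yY; exists z => //;
    exists y.
- by move=> z /sur'[y yY Syz]; have [x xX Rxy] := sur _ yY; exists x => //;
    exists y.
- move=> x x' z z' xX x'X zZ z'Z [y yY [Rxy Syz]] [y' y'Y [Rx'y' Sy'z']].
  have := inj x x' y y' xX x'X yY y'Y Rxy Rx'y'.
  by have := inj' y y' z z' yY y'Y zZ z'Z Syz Sy'z' => -> ->.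
Qed.

(** * Adding and removing one element *)

Definition is_adjunction y x a : Prop := forall z, z ∈ y <-> z ∈ x \/ z = a.
Definition is_removal y x a : Prop := forall z, z ∈ y <-> z ∈ x /\ z <> a.

Lemma adjunction_exists x a : is_set x -> exists y, is_set y /\ is_adjunction y x a.
Proof.
move=> sx; have [u [su Hu]] := zfa_pair HZ a a; have [v [sv Hv]] := zfa_pair HZ x u.
have [y [sy Hy]] := zfa_union HZ sv; exists y; split=> // z.
rewrite Hy; split=> [[t /Hv[->|->]]|[zx|->]]; [by left|by move/Hu=> [] ->;
    right| |].
  by exists x => //; apply/Hv; left.
by exists u; [apply/Hv; right|apply/Hu; left].
Qed.

Lemma removal_exists x a : is_set x -> exists y, is_set y /\ is_removal y x a.
Proof. by apply: separation; definability. Qed.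

Lemma succ_exists n : is_set n -> exists s, is_succ s n.
Proof. exact: adjunction_exists. Qed.

Lemma elem_irrefl x : ~ x ∈ x.
Proof.
move=> xx; have [u [su Hu]] := zfa_pair HZ x x.
have [|y yu ymin] := zfa_foundation HZ (x := u); first by exists x; apply/Hu; left.
have yx : y = x by case/Hu: yu.
by subst y; apply: (ymin x).
Qed.

(** The bijection is rerouted: the element sent to [b], if it is not [a] itself, takes over the
    image of [a]. *)
Lemma equipotent_removal X Y a b X' Y' : equipotent X Y -> a ∈ X -> b ∈ Y ->
  is_removal X' X a -> is_removal Y' Y b -> equipotent X' Y'.
Proof.
case/equipotentE=> R dR [tot sur inj] aX bY HX' HY'.
apply: (@equipotentI (fun x y => R x y \/ R x b /\ R a y)); first by definability.
split.
- move=> x /HX'[xX xa]; have [y yY Rxy] := tot _ xX.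
  have [yb|yb] := lem (y = b); last by exists y; [apply/HY'|left].
  rewrite yb in Rxy; have [c cY Rac] := tot _ aX; exists c; last by right.
  by apply/HY'; split=> // cb; apply: xa; apply/(inj x a b c).
- move=> y /HY'[yY yb]; have [x xX Rxy] := sur _ yY.
  have [xa|xa] := lem (x = a); last by exists x; [apply/HX'|left].
  rewrite xa in Rxy; have [c cX Rcb] := sur _ bY; exists c; last by right.
  by apply/HX'; split=> // ca; apply: yb; apply/(inj a c y b).
- move=> x x' y y' /HX'[xX xa] /HX'[x'X x'a] /HY'[yY yb] /HY'[y'Y y'b].
  case=> [Rxy|[Rxb Ray]] [Rx'y'|[Rx'b Ray']].
  + exact: inj.
  + split=> E; exfalso; [apply: yb; apply/(inj x x' y b)|apply: xa;
      apply/(inj x a y y')] => //.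
  + split=> E; exfalso; [apply: y'b; apply/(inj x' x y' b)|apply: x'a;
      apply/(inj x' a y' y)] => //.
  + split=> _; [apply/(inj a a y y')|apply/(inj x x' b b)] => //.
Qed.

Lemma equipotent_adjunction X Y a b X' Y' : equipotent X Y -> ~ a ∈ X -> ~ b ∈ Y ->
  is_adjunction X' X a -> is_adjunction Y' Y b -> equipotent X' Y'.
Proof.
case/equipotentE=> R dR [tot sur inj] aX bY HX' HY'.
apply: (@equipotentI (fun x y => [/\ x ∈ X, y ∈ Y & R x y] \/ x = a /\ y = b));
    first by definability.
split.
- move=> x /HX'[xX|->]; last by exists b; [apply/HY'; right|right].
  by have [y yY Rxy] := tot _ xX; exists y; [apply/HY'; left|left].
- move=> y /HY'[yY|->]; last by exists a; [apply/HX'; right|right].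
  by have [x xX Rxy] := sur _ yY; exists x; [apply/HX'; left|left].
- move=> x x' y y' _ _ _ _.
  case=> [[xX yY Rxy]|[-> ->]] [[x'X y'Y Rx'y']|[-> ->]] //.
  + exact: inj.
  + by split=> E; [case: aX|case: bY]; rewrite -?E // E.
  + by split=> E; [case: aX|case: bY]; rewrite -?E // E.
Qed.

Lemma equipotent_nonempty X Y a : equipotent X Y -> a ∈ X -> exists b, b ∈ Y.
Proof. by case/equipotentE=> R _ [tot _ _] /tot[b bY _]; exists b. Qed.

(** Belonging to every inductive set is a definable condition, so separation cuts the intersection
    of all inductive sets out of one of them. *)
Lemma omega_exists : exists w : N, is_omega w.
Proof.
have [I HI] := zfa_infinity HZ; case: (HI) => sI I0 IS.
have [w [sw Hw]] := @separation (fun n => forall v, inductive_set v ->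
  n ∈ v) I ltac:(definability) sI.
exists w; split; last by move=> v Hv n /Hw[_ /(_ v Hv)].
split=> //.
  by move=> z ez; apply/Hw; split; [exact: I0|move=> v [_ v0 _]; exact: v0].
move=> n s /Hw[nI nv] sn; apply/Hw; split; first exact: IS nI sn.
by move=> v Hv; case: (Hv) => _ _ vS; exact: vS (nv _ Hv) sn.
Qed.

Lemma omega_unique (w w' : N) : is_omega w -> is_omega w' -> w = w'.
Proof.
case=> Iw mw [Iw' mw']; apply: set_ext; [by case: Iw|by case: Iw'|].
by move=> z; split; [exact: mw|exact: mw'].
Qed.

(** * Induction, order and counting on the natural numbers of the structure *)

Section Omega.
Variable w : N.
Hypothesis Hw : is_omega w.

Lemma in_omegaE n : in_omega n <-> n ∈ w.
Proof.
by split=> [[w' Hw']|nw]; [rewrite (omega_unique Hw' Hw)|exists w].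
Qed.

Lemma omega_is_set : is_set w.
Proof. by case: Hw => -[]. Qed.

Lemma omega_empty n : is_empty n -> n ∈ w.
Proof. by case: Hw => -[_ + _] _; apply. Qed.

Lemma omega_succ n s : n ∈ w -> is_succ s n -> s ∈ w.
Proof. by case: Hw => -[_ _ +] _; apply. Qed.

(** By separation the numbers satisfying [P] form an inductive set. Definability cannot be dropped,
    since [w] may be nonstandard. *)
Lemma omega_ind P : definable1 P -> (forall z, is_empty z -> P z) ->
  (forall n s, n ∈ w -> P n -> is_succ s n -> P s) -> forall n, n ∈ w -> P n.
Proof.
move=> dP P0 PS; have [v [sv Hv]] := separation dP omega_is_set.
suff Iv : inductive_set v by move=> n; case: Hw => _ /(_ v Iv n)/[apply]/Hv[].
split=> // [z ez|n s /Hv[nw Pn] sn]; apply/Hv.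
  by split; [exact: omega_empty|exact: P0].
by split; [exact: omega_succ sn|exact: PS sn].
Qed.

Lemma nat_is_set n : n ∈ w -> is_set n.
Proof. by move: n; apply: omega_ind; [definability|move=> z []|move=> n s _ _ []]. Qed.

Lemma omega_cases n : n ∈ w -> is_empty n \/ exists2 m, m ∈ w & is_succ n m.
Proof.
by move: n; apply: omega_ind; [definability|left|move=> n s nw _ sn; right;
    exists n].
Qed.

Lemma elem_omega n m : n ∈ w -> m ∈ n -> m ∈ w.
Proof.
move=> nw; move: n nw m; apply: omega_ind; first by definability.
  by move=> z [_ ez] m /ez.
by move=> n s nw IH [_ Hs] m /Hs[/IH|->].
Qed.

Lemma nat_trans n m k : n ∈ w -> m ∈ n -> k ∈ m -> k ∈ n.
Proof.
move=> nw; move: n nw m k; apply: omega_ind; first by definability.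
  by move=> z [_ ez] m k /ez.
move=> n s nw IH [_ Hs] m k /Hs[mn km|->]; last by move=> kn; apply/Hs; left.
by apply/Hs; left; exact: IH km.
Qed.

Lemma nat_empty_le n z : n ∈ w -> is_empty z -> z = n \/ z ∈ n.
Proof.
move=> nw [sz ez]; move: n nw; apply: omega_ind; first by definability.
  by move=> n [sn en]; left; apply: set_ext => // t; split=> [/ez|/en].
by move=> n s nw IH [_ Hs]; right; apply/Hs; case: IH => [->|]; [right|left].
Qed.

Lemma nat_succ_le n m s : n ∈ w -> m ∈ n -> is_succ s m -> s = n \/ s ∈ n.
Proof.
move=> nw; move: n nw m s; apply: omega_ind; first by definability.
  by move=> z [_ ez] m s /ez.
move=> n s' nw IH [ss' Hs'] m s /Hs'[mn sm|-> [ss Hs]].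
  by right; apply/Hs'; case: (IH _ _ mn sm) => [->|]; [right|left].
by left; apply: set_ext => // z; rewrite Hs Hs'.
Qed.

Lemma nat_total n m : n ∈ w -> m ∈ w -> [\/ n ∈ m, n = m | m ∈ n].
Proof.
(* Binary disjunctions replace the ternary one, since [definability] decomposes only the former. *)
move=> nw mw; suff: n ∈ m \/ n = m \/ m ∈ n by case=> [|[]]; constructor.
move: n nw m mw; apply: omega_ind; first by definability.
  by move=> z ez m mw; case: (nat_empty_le mw ez) => [->|]; [right; left|left].
move=> n s nw IH sn m mw; case: (sn) => _ Hs; case: (IH m mw) => [nm|[nm|mn]].
- by case: (nat_succ_le mw nm sn) => [->|]; [right; left|left].
- by right; right; apply/Hs; right.
- by right; right; apply/Hs; left.
Qed.

Lemma nat_succ_mono n m s t : m ∈ w -> n ∈ m -> is_succ s n -> is_succ t m -> s ∈ t.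
Proof.
by move=> mw nm sn [_ Ht]; apply/Ht; case: (nat_succ_le mw nm sn) => [->|];
    [right|left].
Qed.

(** The order is membership, so foundation supplies the minimal element. *)
Lemma omega_least P : definable1 P -> (exists2 n, n ∈ w & P n) ->
  exists n, [/\ n ∈ w, P n & forall m, m ∈ n -> ~ P m].
Proof.
move=> dP [n nw Pn]; have [A [sA HA]] := separation dP omega_is_set.
have [|m mA mmin] := zfa_foundation HZ (x := A); first by exists n; apply/HA.
have [mw Pm] := HA m; case/HA: (mA) => mw' Pm'.
exists m; split=> // k km Pk; apply: (mmin k _ km); apply/HA; split=> //.
exact: elem_omega km.
Qed.

(** Induction on [n]: when both numbers are successors, removing the top element of each leaves
    equipotent predecessors. *)
Lemma nat_equipotent_eq n m : n ∈ w -> m ∈ w -> equipotent n m -> n = m.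
Proof.
move: n m; suff: forall n, n ∈ w -> forall m, m ∈ w -> equipotent n m ->
  n = m by move=> H n m *; apply: H.
apply: omega_ind; first by definability.
  move=> z ez m mw /equipotent_sym zm; case: (nat_empty_le mw ez) => // zm'.
  by have [b] := equipotent_nonempty zm zm'; case: ez => _ /(_ b).
move=> n s nw IH [ss Hs] m mw sm.
have ns : n ∈ s by apply/Hs; right.
case: (omega_cases mw) => [[_ em]|[k kw [sm' Hm]]].
  by have [b /em] := equipotent_nonempty sm ns.
have km : k ∈ m by apply/Hm; right.
suff nk : n = k by apply: set_ext => // z; rewrite Hs Hm nk.
apply: IH => //; apply: (equipotent_removal sm ns km) => z.
  rewrite Hs; split=> [zn|[[]//]]; split; first by left.
  by move=> zE; apply: (@elem_irrefl n); rewrite -{1}zE.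
rewrite Hm; split=> [zk|[[]//]]; split; first by left.
by move=> zE; apply: (@elem_irrefl k); rewrite -{1}zE.
Qed.

(** * Finite sets and their cardinalities *)

Lemma finite_setE X : finite_set X <-> is_set X /\ exists2 n,
    n ∈ w & equipotent X n.
Proof.
split=> -[sX [n nw Xn]]; split=> //; exists n => //; first by apply/in_omegaE.
by apply/in_omegaE.
Qed.

Lemma finite_set_empty x : is_empty x -> finite_set x.
Proof.
by move=> ex; apply/finite_setE; split; [case: ex|exists x;
    [exact: omega_empty|exact: equipotent_refl]].
Qed.

Lemma equipotent_adjunction_succ x a y n s : equipotent x n -> ~ a ∈ x ->
  is_adjunction y x a -> is_succ s n -> equipotent y s.
Proof.
move=> xn ax Hy [_ Hs]; exact: equipotent_adjunction xn ax (@elem_irrefl n) Hy Hs.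
Qed.

Lemma finite_set_adjunction x a y : finite_set x -> is_set y ->
  is_adjunction y x a -> finite_set y.
Proof.
move=> Fx sy Hy; have [ax|ax] := lem (a ∈ x).
  suff -> : y = x by [].
  by apply: set_ext => //; [case: Fx|move=> z; rewrite Hy; split=> [[|->]|];
      [| |left]].
case/finite_setE: Fx => sx [n nw xn]; apply/finite_setE; split=> //.
have [s sn] := succ_exists (nat_is_set nw).
by exists s; [exact: omega_succ sn|exact: equipotent_adjunction_succ xn ax Hy sn].
Qed.

(** Induction on the number of elements, over all sets of that size at once; any element may be the
    one removed. *)
Lemma finite_set_ind P : definable1 P -> (forall x, is_empty x -> P x) ->
  (forall x a y, finite_set x -> ~ a ∈ x -> is_set y -> is_adjunction y x a ->
    P x -> P y) ->
  forall x, finite_set x -> P x.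
Proof.
move=> dP P0 PS x /finite_setE[sx [n nw]].
move: n nw x sx; apply: omega_ind; first by definability.
  move=> z [_ ez] x sx xz; apply: P0; split=> // t tx.
  by have [b /ez] := equipotent_nonempty xz tx.
move=> n s nw IH [_ Hs] x sx xs.
have ns : n ∈ s by apply/Hs; right.
have [a ax] := equipotent_nonempty (equipotent_sym xs) ns.
have [y [sy Hy]] := removal_exists a sx.
have yn : equipotent y n.
  apply: (equipotent_removal xs ax ns Hy) => z.
  rewrite Hs; split=> [zn|[[]//]]; split; first by left.
  by move=> zE; apply: (@elem_irrefl n); rewrite -{1}zE.
apply: (PS y a x) => //; last exact: IH.
- by apply/finite_setE; split=> //; exists n.
- by move/Hy=> [].
- move=> z; rewrite Hy; split; last by case=> [[]|->].
  by have [->|za] := lem (z = a); [right|left].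
Qed.

Lemma finite_set_sub x y : finite_set x -> is_set y -> incl y x -> finite_set y.
Proof.
move=> Fx; move: x Fx y; apply: finite_set_ind; first by definability.
  by move=> x [_ ex] y sy yx; apply: finite_set_empty; split=> // z /yx/ex.
move=> x a x' Fx ax sx' Hx' IH y sy yx'.
have [z [sz Hz]] := removal_exists a sy.
have Fz : finite_set z.
  by apply: IH => // t /Hz[ty ta]; case/Hx': (yx' _ ty).
have [ay|ay] := lem (a ∈ y).
  apply: (finite_set_adjunction (a := a)) Fz sy _ => t; rewrite Hz; split;
      last by case=> [[]|->].
  by have [->|ta] := lem (t = a); [right|left].
suff -> : y = z by [].
by apply: set_ext => // t; rewrite Hz; split=> [ty|[]//]; split=> // ta;
    apply: ay; rewrite -ta.
Qed.

Lemma finite_set_equipotent X Y : finite_set X -> is_set Y -> equipotent X Y ->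
  finite_set Y.
Proof.
move=> /finite_setE[sX [n nw Xn]] sY XY; apply/finite_setE; split=> //;
    exists n => //.
exact: equipotent_trans (equipotent_sym XY) Xn.
Qed.

Lemma finite_set_setU x y z : finite_set x -> finite_set y -> is_set z ->
  (forall t, t ∈ z <-> t ∈ x \/ t ∈ y) -> finite_set z.
Proof.
move=> Fx Fy; move: y Fy z; apply: finite_set_ind; first by definability.
  move=> y [_ ey] z sz Hz; suff -> : z = x by [].
  apply: set_ext => //; first by case: Fx.
  by move=> t; rewrite Hz; split=> [[|/ey]|]; [| |left].
move=> y a y' Fy ay sy' Hy' IH z sz Hz.
have dxy : definable1 (fun t => t ∈ x \/ t ∈ y) by definability.
have [u [su Hu]] := separation dxy sz.
have Fu : finite_set u.
  by apply: IH => // t; rewrite Hu Hz Hy'; tauto.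
by apply: (finite_set_adjunction (a := a)) Fu sz _ => t; rewrite Hu Hz Hy'; tauto.
Qed.

Lemma finite_set_union F u : finite_set F -> (forall x, x ∈ F -> finite_set x) ->
  is_union u F -> finite_set u.
Proof.
move=> FF; move: F FF u; apply: finite_set_ind; first by definability.
  move=> F [_ eF] u _ [su Hu]; apply: finite_set_empty; split=> // z /Hu[y /eF].
  by [].
move=> F a F' FF aF sF' HF' IH u fin [su Hu].
have [v Hv] := zfa_union HZ (proj1 FF).
have Fv : finite_set v by apply: IH Hv => x xF; apply: fin; apply/HF'; left.
have Fa : finite_set a by apply: fin; apply/HF'; right.
apply: finite_set_setU Fv Fa su _ => t; case: Hv => _ Hv; rewrite Hu Hv.
split=> [[x /HF'[xF|->] tx]|[[x xF tx]|ta]]; [by left; exists x|by right| |].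
  by exists x => //; apply/HF'; left.
by exists a => //; apply/HF'; right.
Qed.

(** [R] may be partial on [X], so the induction step asks whether the added element has an image. *)
Lemma finite_set_image R X Y : definable2 R ->
  (forall x y y', x ∈ X -> R x y -> R x y' -> y = y') -> finite_set X -> is_set Y ->
  (forall y, y ∈ Y <-> exists2 x, x ∈ X & R x y) -> finite_set Y.
Proof.
move=> dR Rfun FX; move: X FX Rfun Y; apply: finite_set_ind; first by definability.
  by move=> X [_ eX] _ Y sY HY; apply: finite_set_empty; split=> // z /HY[x /eX].
move=> X a X' FX aX sX' HX' IH Rfun Y sY HY.
have dRX : definable1 (fun y => exists2 x, x ∈ X & R x y) by definability.
have [Z [sZ HZ']] := separation dRX sY.
have FZ : finite_set Z.
  apply: IH => // [x y y' xX|y]; first by apply: Rfun; apply/HX'; left.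
  rewrite HZ'; split=> [[]//|[x xX Rxy]]; split; last by exists x.
  by apply/HY; exists x => //; apply/HX'; left.
have [[b Rab]|nRa] := lem (exists b, R a b).
  apply: (finite_set_adjunction (a := b)) FZ sY _ => y; rewrite HZ';
      split=> [yY|[[]//|->]].
    case/HY: (yY) => x /HX'[xX|->] Rxy; first by left; split=> //; exists x.
    by right; apply: Rfun Rxy Rab; apply/HX'; right.
  by apply/HY; exists a => //; apply/HX'; right.
suff -> : Y = Z by [].
apply: set_ext => // y; rewrite HZ'; split=> [yY|[]//]; split=> //.
by case/HY: (yY) => x /HX'[xX|->] Rxy; [exists x|case: nRa; exists y].
Qed.

(** Induction on the larger set [y]. Its new element [a] is removed from [z]: if [a] was there, both
    counts grow by one, otherwise only that of [y] does. *)
Lemma nat_card_mono y z j k : incl z y -> is_set z -> j ∈ w -> k ∈ w ->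
  equipotent z j -> equipotent y k ->
  is_set y -> j = k \/ j ∈ k.
Proof.
move=> zy sz jw kw zj yk sy.
have Fy : finite_set y by apply/finite_setE; split=> //; exists k.
move: y Fy {sy} z j k jw kw sz zy zj yk; apply: finite_set_ind;
    first by definability.
  move=> y [_ ey] z j k jw kw sz zy zj yk; apply: nat_empty_le => //.
  split=> [|t tj]; first exact: nat_is_set jw.
  by have [b /zy/ey] := equipotent_nonempty (equipotent_sym zj) tj.
move=> y a y' Fy ay sy' Hy' IH z j k jw kw sz zy' zj yk.
have [sy [k0 k0w yk0]] := proj1 (finite_setE _) Fy.
have [s sk0] := succ_exists (nat_is_set k0w).
have -> : k = s.
  apply: nat_equipotent_eq => //; first exact: omega_succ sk0.
  apply: equipotent_trans (equipotent_sym yk) _.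
  exact: equipotent_adjunction_succ yk0 ay Hy' sk0.
have [t [st Ht]] := removal_exists a sz.
have ty : incl t y by move=> x /Ht[/zy'/Hy'[]].
have Ft : finite_set t by exact: finite_set_sub Fy st ty.
have [_ [j0 j0w tj0]] := proj1 (finite_setE _) Ft.
have jk := IH _ _ _ j0w k0w st ty tj0 yk0.
have [az|az] := lem (a ∈ z).
  have [r rj0] := succ_exists (nat_is_set j0w).
  have -> : j = r.
    apply: nat_equipotent_eq => //; first exact: omega_succ rj0.
    apply: equipotent_trans (equipotent_sym zj) _.
    apply: equipotent_adjunction_succ tj0 _ _ rj0; first by move=> /Ht[].
    move=> x; rewrite Ht; split; last by case=> [[]|->].
    by have [->|xa] := lem (x = a); [right|left].
  case: jk => [E|jk]; last by right; exact: nat_succ_mono k0w jk rj0 sk0.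
  by left; case: rj0 sk0 => sr Hr [ss Hs]; apply: set_ext => // x; rewrite Hr Hs E.
have -> : j = j0.
  apply: nat_equipotent_eq => //.
  apply: equipotent_trans (equipotent_sym zj) _.
  suff -> : z = t by [].
  by apply: set_ext => // x; rewrite Ht; split=> [xz|[]//]; split=> // xa;
      apply: az; rewrite -xa.
by right; case: sk0 => _ Hs; apply/Hs; case: jk; [right|left].
Qed.

Lemma nat_not_le_succ n s : n ∈ w -> is_succ s n -> ~ (s = n \/ s ∈ n).
Proof.
move=> nw [_ Hs]; have ns : n ∈ s by apply/Hs; right.
case=> [E|sn]; first by rewrite E in ns; exact: elem_irrefl ns.
by apply: (@elem_irrefl n); exact: nat_trans sn ns.
Qed.

Lemma nat_finite n : n ∈ w -> finite_set n.
Proof.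
by move=> nw; apply/finite_setE; split; [exact: nat_is_set|exists n => //;
    exact: equipotent_refl].
Qed.

Lemma nat_incl n : n ∈ w -> incl n w.
Proof. by move=> nw m; exact: elem_omega. Qed.

(** If [w] had [n] elements, its subset, the successor of [n], would have at most [n]. *)
Lemma omega_not_finite : ~ finite_set w.
Proof.
case/finite_setE=> sw [n nw wn]; have [s sn] := succ_exists (nat_is_set nw).
have sw' := omega_succ nw sn.
apply: (nat_not_le_succ nw sn).
exact: nat_card_mono (nat_incl sw') (nat_is_set sw') sw' nw (equipotent_refl _) wn sw.
Qed.

(* [n |-> |I ∩ n|] enumerates [I]; no recursion on [w] is needed. *)
Lemma omega_infinite_subset I : is_set I -> incl I w -> ~ finite_set I ->
  equipotent I w.
Proof.
move=> sI Iw IF.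
pose R n k := k ∈ w /\ exists z, [/\ is_set z, forall t,
    t ∈ z <-> t ∈ I /\ t ∈ n & equipotent z k].
have dR : definable2 R by rewrite /R; definability.
(* For [n] below [n'], the set [I ∩ n'] contains [I ∩ n] and also [n], so its count is strictly
   larger. *)
have Rlt n n' k : R n k -> R n' k -> n ∈ I -> n' ∈ w -> n ∈ n' -> False.
  case=> kw [z [sz Hz zk]] [_ [z' [sz' Hz' zk']]] nI n'w nn'.
  have [s sk] := succ_exists (nat_is_set kw).
  have [y [sy Hy]] := adjunction_exists n sz.
  apply: (nat_not_le_succ kw sk).
  apply: (nat_card_mono _ sy (omega_succ kw sk) kw _ zk' sz').
    move=> t /Hy[/Hz[tI tn]|->]; apply/Hz'; split=> //; exact: nat_trans tn.
  by apply: (equipotent_adjunction_succ zk _ Hy sk); move=> /Hz[_];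
      exact: elem_irrefl.
apply: (equipotentI dR); split.
- move=> n nI; have nw := Iw _ nI.
  have dI : definable1 (fun t => t ∈ I) by definability.
  have [z [sz Hz]] := separation dI (nat_is_set nw).
  have /finite_setE[_ [k kw zk]] : finite_set z.
    by apply: finite_set_sub (nat_finite nw) sz _ => t /Hz[].
  by exists k => //; split=> //; exists z; split=> // t; rewrite Hz; tauto.
(* Every count is attained: 0 at the least element of [I], and a successor at the next element of
   [I] after [n]. That element exists, since otherwise [I] would lie inside the finite successor of
   [n]. *)
- apply: omega_ind; first by definability.
    move=> k ek.
    have [I0|nI0] := lem (exists2 n, n ∈ w & n ∈ I); last first.
      by case: IF; apply: finite_set_empty; split=> // n nI; apply: nI0;
          exists n => //; exact: Iw.
    have dI : definable1 (fun t => t ∈ I) by definability.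
    have [n [nw nI nmin]] := omega_least dI I0.
    exists n => //; split; first exact: omega_empty.
    exists k; split; [by case: ek| |exact: equipotent_refl].
    by case: ek => _ ek t; split=> [/ek//|[tI /nmin]].
  move=> k s kw [n nI [_ [z [sz Hz zk]]]] sk; have nw := Iw _ nI.
  have dJ : definable1 (fun m => m ∈ I /\ n ∈ m) by definability.
  have [|m [mw [mI nm] mmin]] := omega_least dJ.
    apply: contrapT => noJ; apply: IF.
    have [r rn] := succ_exists (nat_is_set nw).
    apply: finite_set_sub (nat_finite (omega_succ nw rn)) sI _ => t tI;
        case: rn => _ Hr; apply/Hr.
    case: (nat_total (Iw _ tI) nw) => nt; [by left|by right|].
    by case: noJ; exists t => //; exact: Iw.
  exists m => //; split; first exact: omega_succ sk.
  have [y [sy Hy]] := adjunction_exists n sz.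
  exists y; split=> // [t|].
    rewrite Hy Hz; split=> [[[tI tn]|->//]|[tI tm]]; first by split=> //;
        exact: nat_trans tn.
    case: (nat_total (Iw _ tI) nw) => nt; [by left|by right|].
    by case: (mmin _ tm).
  by apply: (equipotent_adjunction_succ zk _ Hy sk); move=> /Hz[_];
      exact: elem_irrefl.
- move=> n n' k k' nI n'I kw k'w Rnk Rn'k'; split=> E.
    subst n'; case: Rnk Rn'k' => _ [z [sz Hz zk]] [_ [z' [sz' Hz' zk']]].
    apply: nat_equipotent_eq => //; apply: equipotent_trans (equipotent_sym zk) _.
    suff -> : z = z' by [].
    by apply: set_ext => // t; rewrite Hz Hz'.
  subst k'; case: (nat_total (Iw _ nI) (Iw _ n'I)) => // nn'; exfalso.
    exact: Rlt Rnk Rn'k' nI (Iw _ n'I) nn'.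
  exact: Rlt Rn'k' Rnk n'I (Iw _ nI) nn'.
Qed.

End Omega.

(** * Denumerable sets *)

Lemma denumerable_not_finite D : denumerable D -> ~ finite_set D.
Proof.
case=> _ [w Hw Dw] FD; apply: (omega_not_finite Hw).
exact: (finite_set_equipotent Hw) (omega_is_set Hw) Dw.
Qed.

Lemma denumerable_equipotent D (D' : N) : denumerable D -> is_set D' ->
  equipotent D D' -> denumerable D'.
Proof.
case=> _ [w Hw Dw] sD' DD'; split=> //; exists w => //.
exact: equipotent_trans (equipotent_sym DD') Dw.
Qed.

(** Each member of [Y] is labelled by the least index of a preimage, so no choice is made. The
    labels form an infinite subset of [w], to which [omega_infinite_subset] applies. *)
Lemma countable_image D Y R : denumerable D -> definable2 R -> is_set Y ->
  (forall x y y', x ∈ D -> R x y -> R x y' -> y = y') ->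
  (forall y, y ∈ Y -> exists2 x, x ∈ D & R x y) -> ~ finite_set Y -> denumerable Y.
Proof.
case=> sD [w Hw /equipotentE[S dS [tot sur inj]]] dR sY Rfun Rsur YF; split=> //;
    exists w => //.
pose T0 n y := exists2 d, d ∈ D & S d n /\ R d y.
pose T n y := [/\ n ∈ w, y ∈ Y, T0 n y & forall m, m ∈ n -> ~ T0 m y].
have dT0 : definable2 T0 by rewrite /T0; definability.
have dT : definable2 T by rewrite /T; definability.
have dI : definable1 (fun n => exists y, T n y) by definability.
have [I [sI HI]] := separation dI (omega_is_set Hw).
have Iw : incl I w by move=> n /HI[].
have IY : equipotent I Y.
  apply: (equipotentI dT); split.
  - by move=> n /HI[_ [y Tny]]; exists y => //; case: Tny.
  - move=> y yY; have dP : definable1 (fun n => T0 n y) by definability.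
    have [|n [nw Tny nmin]] := omega_least Hw dP.
      have [d dD Rdy] := Rsur _ yY; have [n nw Sdn] := tot _ dD.
      by exists n => //; exists d.
    exists n; last by split.
    by apply/HI; split=> //; exists y; split.
  - move=> n n' y y' nI n'I yY y'Y [nw _ Tny nmin] [n'w _ Tny' nmin'].
    split=> E; subst.
      case: Tny Tny' => d dD [Sdn Rdy] [d' d'D [Sd'n' Rd'y']].
      have E : d = d' by apply/(inj d d' n' n').
      by subst d'; exact: Rfun Rdy Rd'y'.
    case: (nat_total Hw nw n'w) => // nn'; first by case: (nmin' _ nn').
    by case: (nmin _ nn').
apply: equipotent_trans (equipotent_sym IY) _.
apply: omega_infinite_subset => // FI; apply: YF.
exact: (finite_set_equipotent Hw) FI sY IY.
Qed.

Lemma denumerable_sub D I : denumerable D -> is_set I -> incl I D ->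
  ~ finite_set I -> denumerable I.
Proof.
move=> DD sI ID IF; apply: (countable_image (R := eq)) DD _ sI _ _ IF;
    first by definability.
  by move=> x y y' _ <-.
by move=> y /ID yD; exists y.
Qed.

Lemma infinite_setE X : infinite_set X <-> is_set X /\ ~ finite_set X.
Proof.
split=> -[sX H]; split=> //; first by case=> _ [n nw]; exact: H.
by move=> n nw Xn; apply: H; split=> //; exists n.
Qed.

(** * Finite subsets and choice principles *)

Lemma denumerable_omega w : is_omega w -> denumerable w.
Proof. by move=> Hw; split; [exact: omega_is_set|exists w => //;
    exact: equipotent_refl]. Qed.

Lemma finsubsets_exists X : is_set X -> exists S, is_finsubsets S X.
Proof.
move=> sX; have [p [sp Hp]] := zfa_power HZ sX.
have dF : definable1 (fun z : N => finite_set z) by definability.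
have [S [sS HS]] := separation dF sp.
by exists S; split=> // z; rewrite HS Hp; split=> [[[]]|[Fz zX]] //; split=> //;
    split=> //; case: Fz.
Qed.

Lemma nsubsets_exists X n : is_set X -> exists S, is_nsubsets S X n.
Proof.
move=> sX; have [p [sp Hp]] := zfa_power HZ sX.
have dE : definable1 (fun z => equipotent z n) by definability.
have [S [sS HS]] := separation dE sp.
by exists S; split=> // z; rewrite HS Hp; split=> [[[]]|[]].
Qed.

Lemma nsubsets_unique S S' X n : is_nsubsets S X n -> is_nsubsets S' X n -> S = S'.
Proof. by case=> sS HS [sS' HS']; apply: set_ext => // z; rewrite HS HS'. Qed.

Lemma infinite_set_nsubset w X n : is_omega w -> infinite_set X -> n ∈ w ->
  exists z, [/\ is_set z, incl z X & equipotent z n].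
Proof.
move=> Hw /infinite_setE[sX FX]; move: n; apply: (omega_ind Hw);
    first by definability.
  by move=> z [sz ez]; exists z; split=> //; [move=> t /ez|exact: equipotent_refl].
move=> n s nw [z [sz zX zn]] sn.
have [a [aX az]] : exists a, a ∈ X /\ ~ a ∈ z.
  apply: contrapT => nex; apply: FX; apply: (finite_set_sub Hw) sX _.
    by apply/(finite_setE Hw); split; [exact: sz|exists n].
  by move=> a aX; apply: contrapT => az; apply: nex; exists a.
have [y [sy Hy]] := adjunction_exists a sz.
exists y; split=> //; first by move=> t /Hy[/zX|->].
exact: equipotent_adjunction_succ zn az Hy sn.
Qed.

Lemma CMC_IQDI : CMC N -> IQDI N.
Proof.
move=> cmc X infX; have [w Hw] := omega_exists; have sw := omega_is_set Hw.
have [sX FX] := proj1 (infinite_setE _) infX.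
have [Fin HFin] := finsubsets_exists sX; exists Fin => //.
have dns : definable2 (fun n S => is_nsubsets S X n) by definability.
have [F [sF HF]] := replacement dns sw (fun n S S' _ => @nsubsets_unique S S' X n).
have inhabited n S : n ∈ w -> is_nsubsets S X n ->
  exists2 z, z ∈ S & equipotent z n.
  move=> nw [_ HS]; have [z [sz zX zn]] := infinite_set_nsubset Hw infX nw.
  by exists z => //; apply/HS.
(* Distinct [n] give distinct sets of subsets, because each of them contains a set with exactly [n]
   elements. *)
have DF : denumerable F.
  apply: denumerable_equipotent (denumerable_omega Hw) sF _;
      apply: (equipotentI dns); split.
  - by move=> n nw; have [S HS] := nsubsets_exists n sX; exists S => //;
      apply/HF; exists n.
  - by move=> S /HF[n nw HS]; exists n.
  - move=> n m S T nw mw _ _ HS HT; split=> E; subst;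
      first exact: nsubsets_unique HS HT.
    have [z /HT.2[_ _ zm] zn] := inhabited _ _ nw HS.
    by apply: (nat_equipotent_eq Hw) => //;
        exact: equipotent_trans (equipotent_sym zn) zm.
have [|U [P [f [HU HP Ff Hf]]]] := cmc F DF.
  move=> S /HF[n nw HS]; split; first by case: HS.
  by have [z zS _] := inhabited _ _ nw HS; exists z.
pose T n v := exists S y, [/\ is_nsubsets S X n, maps f S y & is_union v y].
have dT : definable2 T by rewrite /T; definability.
have T_props n v : n ∈ w -> T n v ->
    [/\ finite_set v, incl v X & exists z, [/\ is_set z,
        incl z v & equipotent z n]].
  move=> nw [S [y [HS fSy [sv Hv]]]]; have SF : S ∈ F by apply/HF; exists n.
  have [Fy [z zy] yS] := Hf _ _ SF fSy.
  have yP t : t ∈ y -> [/\ is_set t, incl t X & equipotent t n] by move=> /yS;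
      case: HS => _ /(_ t)[].
  split; last by exists z; have [? ? ?] := yP _ zy; split=> // t tz; apply/Hv;
      exists z.
    apply: (finite_set_union Hw) Fy _ (conj sv Hv) => t /yP[st _ tn].
    by apply/(finite_setE Hw); split=> //; exists n.
  by move=> t /Hv[x /yP[_ xX _] /xX].
have T_ex n : n ∈ w -> exists v, T n v.
  move=> nw; have [S HS] := nsubsets_exists n sX.
  have SF : S ∈ F by apply/HF; exists n.
  have [y yP fSy] := function_total Ff SF.
  have [[sy _] _ _] := Hf _ _ SF fSy.
  by have [v Hv] := zfa_union HZ sy; exists v, S, y.
have dran : definable1 (fun v => exists2 n, n ∈ w & T n v) by definability.
have [Ran [sRan HRan]] := separation dran (proj1 HFin).
exists Ran; first by move=> v /HRan[].
apply: (countable_image (denumerable_omega Hw) dT sRan).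
- move=> n v v' _ [S [y [HS fSy [sv Hv]]]] [S' [y' [HS' fSy' [sv' Hv']]]].
  rewrite (nsubsets_unique HS' HS) in fSy';
      rewrite (function_fun Ff fSy' fSy) in Hv'.
  by apply: set_ext => // z; rewrite Hv Hv'.
- by move=> v /HRan[].
(* If only finitely many unions arose, their union [V] would be finite with [m] elements, yet it
   contains the union obtained at the successor of [m]. *)
move=> FRan.
have [V HV] := zfa_union HZ sRan; case: (HV) => sV HV'.
have /(finite_setE Hw)[_ [m mw Vm]] : finite_set V.
  by apply: (finite_set_union Hw) FRan _ HV =>
      v /HRan[_ [n nw /(T_props _ _ nw)[]]].
have [s sm] := succ_exists (nat_is_set Hw mw).
have sw' := omega_succ Hw mw sm.
have [v Tv] := T_ex _ sw'; have [Fv vX [z [sz zv zs]]] := T_props _ _ sw' Tv.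
apply: (nat_not_le_succ Hw mw sm); apply: (nat_card_mono Hw _ sz sw' mw zs Vm sV) => t /zv tv.
apply/HV'; exists v => //; apply/HRan; split; last by exists s.
by apply/(proj2 HFin).
Qed.

(** For [s] equal to 1 the unique element is the choice, as [C_omega] is only available from 2 on. A
    definable relation covers this case and the choice function alike. *)
Lemma selector_exists w D j s : is_omega w -> j ∈ w -> is_succ s j ->
  denumerable D ->
  (forall d, d ∈ D -> is_set d /\ equipotent d s) -> (ge2 s -> C_omega s) ->
  exists R, [/\ definable2 R, forall d, d ∈ D -> exists2 x, x ∈ d & R d x,
    forall d x, d ∈ D -> R d x -> x ∈ d &
    forall d x x', d ∈ D -> R d x -> R d x' -> x = x'].
Proof.
move=> Hw jw sj DD Ds choice_s; have [ss Hs] := sj; have js : j ∈ s by apply/Hs;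
    right.
have [[_ ej]|ne] := lem (is_empty j).
  exists (fun d x => x ∈ d); split=> //; first by definability.
    by move=> d /Ds[_ /equipotent_sym/equipotent_nonempty/(_ js)[x xd]]; exists x.
  move=> d x x' /Ds[_ /equipotentE[R dR [tot _ inj]]] xd x'd.
  have [y ys Rxy] := tot _ xd; have [y' y's Rxy'] := tot _ x'd.
  apply/(inj x x' y y') => //; case/Hs: ys => [/ej//|->];
      case/Hs: y's => [/ej//|->].
  by [].
have [|U [f [HU Ff Hf]]] := choice_s _ D DD Ds.
  (* Since [j] is not 0, the number 1 is at most [j], and so 2 is at most its successor [s]. *)
  have [z ez] := empty_exists; have zw := omega_empty Hw ez.
  have [o oz] := succ_exists (proj1 ez); have [t to] := succ_exists (proj1 oz).
  exists z, o, t; split=> //.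
  have zj : z ∈ j by case: (nat_empty_le Hw jw ez) => // E; case: ne; rewrite -E.
  case: (nat_succ_le Hw jw zj oz) => [E|oj]; last by left;
      exact: (nat_succ_mono Hw) jw oj to sj.
  by right; case: to => st Ht; apply: set_ext => // x; rewrite Ht Hs E.
exists (maps f); split; first exact: definable_maps.
- by move=> d dD; have [x _ fdx] := function_total Ff dD; exists x => //;
    exact: (Hf _ _ dD fdx).
- by move=> d x dD; exact: Hf.
- by move=> d x x' _ fdx fdx'; exact: function_fun Ff fdx fdx'.
Qed.

(** [D] is the union of the fibres of [R], which replacement collects into a family indexed by the
    finite set [Y]. *)
Lemma finite_partition D Y R : is_set D -> is_set Y -> definable2 R ->
  finite_set Y ->
  (forall d, d ∈ D -> exists2 x, x ∈ Y & R d x) ->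
  (forall x E, x ∈ Y -> is_set E -> (forall d, d ∈ E <-> d ∈ D /\ R d x) ->
    finite_set E) ->
  finite_set D.
Proof.
move=> sD sY dR FY Rtot fib; have [w Hw] := omega_exists.
pose T x E := is_set E /\ forall d, d ∈ E <-> d ∈ D /\ R d x.
have dT : definable2 T by rewrite /T; definability.
have Tfun x E E' : x ∈ Y -> T x E -> T x E' -> E = E'.
  by move=> _ [sE HE] [sE' HE']; apply: set_ext => // d; rewrite HE HE'.
have [Fam [sFam HFam]] := replacement dT sY Tfun.
have FFam : finite_set Fam by apply: (finite_set_image Hw dT Tfun FY sFam).
apply: (finite_set_union Hw) FFam _ _.
  by move=> E /HFam[x xY [sE HE]]; exact: fib HE.
split=> // d; split=> [dD|[E /HFam[x xY [_ HE]] /HE[]//]].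
have [x xY Rdx] := Rtot _ dD.
have dRx : definable1 (fun d => R d x) by definability.
have [E [sE HE]] := separation dRx sD.
by exists E; [apply/HFam; exists x|apply/HE].
Qed.

Lemma nsubsets_not_dedekind_infinite w X k S : is_omega w -> is_set X ->
  ~ dedekind_infinite X ->
  (forall n, in_omega n -> ge2 n -> C_omega n) ->
  k ∈ w -> is_nsubsets S X k -> ~ dedekind_infinite S.
Proof.
move=> Hw sX DX Cn kw; move: k kw S; apply: (omega_ind Hw); first by definability.
  (* Only the empty set has 0 elements, so [D] lies inside a singleton. *)
  move=> k [_ ek] S [sS HS] [D DS DD]; apply: (denumerable_not_finite DD).
  have [z ez] := empty_exists.
  have [u [su Hu]] := adjunction_exists z (proj1 ez).
  have Fu := finite_set_adjunction Hw (finite_set_empty Hw ez) su Hu.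
  apply: (finite_set_sub Hw) Fu (proj1 DD) _ => d /DS/HS[sd _ dk]; apply/Hu; right.
  case: ez => sz ez; apply: set_ext => // t; split=> [td|/ez//].
  by have [b /ek] := equipotent_nonempty dk td.
move=> j s jw IH sj S [sS HS] [D DS DD].
have sw := omega_succ Hw jw sj; have iow := proj2 (in_omegaE Hw _) sw.
have Ds d : d ∈ D -> [/\ is_set d, incl d X & equipotent d s] by move/DS/HS.
have [|R [dR Rtot Rsub Rfun]] := selector_exists Hw jw sj DD _ (Cn s iow).
  by move=> d /Ds[].
have dran : definable1 (fun x => exists2 d, d ∈ D & R d x) by definability.
have [Ran [sRan HRan]] := separation dran sX.
have FRan : finite_set Ran.
  apply: contrapT => nF; apply: DX; exists Ran; first by move=> x /HRan[].
  by apply: countable_image DD dR sRan Rfun _ nF => x /HRan[].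
have [x [E [sE HE FE]]] : exists x E, [/\ is_set E, forall d,
    d ∈ E <-> d ∈ D /\ R d x & ~ finite_set E].
  apply: contrapT => nex; apply: (denumerable_not_finite DD).
  apply: (finite_partition (proj1 DD) sRan dR FRan).
    move=> d dD; have [x xd Rdx] := Rtot _ dD; exists x => //; apply/HRan; split;
        last by exists d.
    by have [_ dX _] := Ds _ dD; exact: dX.
  by move=> x E _ sE HE; apply: contrapT => FE; apply: nex; exists x, E.
have DE : denumerable E by apply: denumerable_sub DD sE _ FE => d /HE[].
have drem : definable2 (fun d z => is_set z /\ is_removal z d x).
  by rewrite /is_removal; definability.
have remfun d z z' : d ∈ E -> is_set z /\ is_removal z d x ->
  is_set z' /\ is_removal z' d x -> z = z'.
  by move=> _ [sz Hz] [sz' Hz']; apply: set_ext => // t; rewrite Hz Hz'.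
have [Z [sZ HZ']] := replacement drem sE remfun.
have [Sj HSj] := nsubsets_exists j sX.
apply: (IH _ HSj); exists Z.
  move=> z /HZ'[d /HE[dD Rdx] [sz Hz]]; apply/(proj2 HSj);
      have [sd dX ds] := Ds _ dD.
  split=> //; first by move=> t /Hz[/dX].
  have js : j ∈ s by apply/(proj2 sj); right.
  apply: (equipotent_removal ds (Rsub _ _ dD Rdx) js Hz) => t.
  rewrite (proj2 sj); split=> [tj|[[]//]]; split; first by left.
  by move=> tE; apply: (@elem_irrefl j); rewrite -{1}tE.
apply: denumerable_equipotent DE sZ _; apply: (equipotentI drem); split.
- move=> d dE; have [sd _ _] := Ds _ (proj1 (proj1 (HE _) dE)).
  by have [z Hz] := removal_exists x sd; exists z => //; apply/HZ'; exists d.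
- by move=> z /HZ'[d dE Hz]; exists d.
(* Removing [x] is injective on [E] because all members of [E] contain [x]. *)
- move=> d d' z z' dE d'E _ _ Hz Hz'; split=> Ez; subst; first exact: remfun Hz Hz'.
  case/HE: dE d'E => dD Rdx /HE[d'D Rd'x].
  have [sd _ _] := Ds _ dD; have [sd' _ _] := Ds _ d'D.
  have xd := Rsub _ _ dD Rdx; have xd' := Rsub _ _ d'D Rd'x.
  apply: set_ext => // t; have [->|tx] := lem (t = x); first by split.
  have := proj2 Hz t; rewrite (proj2 Hz' t); tauto.
Qed.

(** Any infinite set that is not Dedekind-infinite will do. It serves all [k] simultaneously, as
    refuting [IDI_F] requires. *)
Lemma not_IDI_k : (forall n, in_omega n -> ge2 n -> C_omega n) -> ~ IDI N ->
  exists2 X, infinite_set X & forall k S, in_omega k -> is_nsubsets S X k ->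
    ~ dedekind_infinite S.
Proof.
move=> Cn nIDI; have [w Hw] := omega_exists.
apply: contrapT => nex; apply: nIDI => X infX; apply: contrapT => DX; apply: nex.
exists X => // k S /(in_omegaE Hw) kw HS.
exact: (nsubsets_not_dedekind_infinite Hw (proj1 infX) DX Cn kw HS).
Qed.

End SetTheory.

(** * Levy's group *)

Section Trees.
Variable A : Type.
Implicit Types (r s t : tree A) (g h : A -> A).

Lemma tree_eq_refl t : tree_eq t t.
Proof. by elim: t => [a|J f IH] //=; split=> i; exists i. Qed.

Lemma tree_eq_sym s t : tree_eq s t -> tree_eq t s.
Proof.
elim: s t => [a|J f IH] [b|K g] //= [fg gf]; split=> i.
  by have [j /IH] := gf i; exists j.
by have [j /IH] := fg i; exists j.
Qed.

Lemma tree_eq_trans s r t : tree_eq s r -> tree_eq r t -> tree_eq s t.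
Proof.
elim: s r t => [a|J f IH] [b|K g] [c|L h] //=; first by move=> ->.
move=> [fg gf] [gh hg]; split=> i.
  by have [j fgj] := fg i; have [k ghk] := gh j; exists k; exact: IH fgj ghk.
by have [j ghj] := hg i; have [k gfk] := gf j; exists k; exact: IH gfk ghj.
Qed.

Lemma tree_mem_eq s s' t t' : tree_eq s s' -> tree_eq t t' -> tree_mem s t ->
  tree_mem s' t'.
Proof.
case: t t' => [a|J f] [b|K g] //= ss' [fg _] [i si]; have [j fgj] := fg i.
by exists j; apply: tree_eq_trans (tree_eq_sym ss') _; apply: tree_eq_trans si fgj.
Qed.

Lemma tree_act_eq g s t : tree_eq s t -> tree_eq (tree_act g s) (tree_act g t).
Proof.
elim: s t => [a|J f IH] [b|K h] //=; first by move=> ->.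
by case=> fg gf; split=> i; [have [j /IH] := fg i|have [j /IH] := gf i]; exists j.
Qed.

Lemma tree_act_comp g h t : tree_act (g \o h) t = tree_act g (tree_act h t).
Proof. by elim: t => [a|J f IH] //=; congr Node; apply: funext. Qed.

Lemma tree_act_id t : tree_act id t = t.
Proof. by elim: t => [a|J f IH] //=; congr Node; apply: funext. Qed.

Lemma tree_act_mem g s t : tree_mem s t -> tree_mem (tree_act g s) (tree_act g t).
Proof. by case: t => [a|J f] //= [i /tree_act_eq-/(_ g)]; exists i. Qed.

End Trees.

(** * The primes and the cyclic generators *)

Lemma nth_prime_prime n : prime (nth_prime n).
Proof.
case: n => [//|n]; rewrite /nth_prime iterS /next_prime.
by case: ex_minnP => p /andP[].
Qed.

Lemma nth_prime_gt n : n < nth_prime n.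
Proof.
elim: n => [//|n IH]; rewrite /nth_prime iterS -/(nth_prime n) /next_prime.
by case: ex_minnP => p /andP[lt_p _] _; exact: leq_ltn_trans lt_p.
Qed.

Lemma iter_ordS p k (i : 'I_p) : iter k (@ordS p) i = (i + k) %% p :> nat.
Proof.
elim: k => [|k IH] /=; first by rewrite addn0 modn_small.
by rewrite IH -addn1 modnDml addn1 addnS.
Qed.

Lemma tag_levy_perm n a : tag (levy_perm n a) = tag a.
Proof. by rewrite /levy_perm; case: ifP. Qed.

Lemma levy_perm_neq n a : tag a != n -> levy_perm n a = a.
Proof. by rewrite /levy_perm => /negbTE->. Qed.

Lemma iter_levy_perm n k (x : 'I_(nth_prime n)) :
  iter k (levy_perm n) (Tagged _ x : levy_atom) = Tagged (fun n =>
      'I_(nth_prime n)) (iter k (@ordS _) x).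
Proof. by elim: k => [//|k IH]; rewrite !iterS IH /levy_perm /= eqxx. Qed.

Lemma levy_permC i j : levy_perm i \o levy_perm j = levy_perm j \o levy_perm i.
Proof.
apply: funext => a /=; have [ai|ai] := eqVneq (tag a) i.
  have [<-//|ij] := eqVneq i j.
  by rewrite !(@levy_perm_neq j) ?tag_levy_perm // ai.
by rewrite !(@levy_perm_neq i) ?tag_levy_perm.
Qed.

Lemma levy_perm_order n : iter (nth_prime n) (levy_perm n) =1 id.
Proof.
move=> [i x]; have [ni|ni] := eqVneq i n.
  subst i; rewrite iter_levy_perm; congr existT; apply: val_inj.
  by rewrite /= iter_ordS modnDr modn_small.
by rewrite iter_fix // levy_perm_neq.
Qed.

Lemma levy_group_tag g a : levy_group g -> tag (g a) = tag a.
Proof.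
move=> Gg; elim: Gg a => {g} [g [n ->]|//|g h _ IHg _ IHh|g h _ IHg gK hK] a.
- exact: tag_levy_perm.
- by rewrite /= IHg IHh.
- by rewrite -IHg hK.
Qed.

Lemma levy_groupC g i : levy_group g -> g \o levy_perm i = levy_perm i \o g.
Proof.
elim=> {g} [g [n ->]|//|g h _ IHg _ IHh|g h _ IHg gK hK].
- exact: levy_permC.
- by rewrite -compA IHh compA IHg.
- apply: funext => a /=; apply: (can_inj gK); rewrite hK.
  by rewrite -[g _]/((g \o levy_perm i) _) IHg /= hK.
Qed.

Definition block_head n : levy_atom :=
  Tagged (fun n => 'I_(nth_prime n)) (Ordinal (prime_gt0 (nth_prime_prime n))).

Lemma block_cyclic (a : levy_atom) : a = iter (nat_of_ord (tagged a)) (levy_perm (tag a)) (block_head (tag a)).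
Proof.
case: a => n x; rewrite iter_levy_perm; congr existT; apply: val_inj.
by rewrite /= iter_ordS add0n modn_small.
Qed.

(** [g] commutes with the generator of the block of [a], whose iterates reach the whole block from
    its head. *)
Lemma levy_group_fix g (a : levy_atom) : levy_group g ->
  g (block_head (tag a)) = block_head (tag a) -> g a = a.
Proof.
move=> Gg gh; rewrite (block_cyclic a).
elim: (nat_of_ord _) => [//|k IH]; rewrite iterS.
by rewrite -[g _]/((g \o levy_perm _) _) levy_groupC //= IH.
Qed.

(** The part of [g] living on the blocks from [m] on. On block-preserving maps this operation
    respects composition. *)
Definition freeze m (g : levy_atom -> levy_atom) (a : levy_atom) : levy_atom :=
  if tag a < m then a else g a.

Lemma freeze_comp m g h : (forall a, tag (h a) = tag a) ->
  freeze m (g \o h) = freeze m g \o freeze m h.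
Proof.
move=> th; apply: funext => a; rewrite /= /freeze /=.
by case: ifP => lt; rewrite ?th lt.
Qed.

(** Induction on the generation of [g]: freezing leaves a generator of index at least [m] unchanged
    and turns the others into the identity. *)
Lemma tree_act_freeze m t g :
  (forall j, m <= j -> tree_eq (tree_act (levy_perm j) t) t) ->
  levy_group g -> tree_eq (tree_act (freeze m g) t) t.
Proof.
move=> Ht; have fid : freeze m id = id by apply: funext => a;
    rewrite /freeze if_same.
elim=> {g} [g [n ->]||g h Gg IHg Gh IHh|g h Gg IHg gK hK].
- case: (leqP m n) => mn.
    have -> : freeze m (levy_perm n) = levy_perm n; last exact: Ht.
    apply: funext => a; rewrite /freeze; case: ifP => // am.
    by rewrite levy_perm_neq // neq_ltn (leq_trans am).
  have -> : freeze m (levy_perm n) = id; last by rewrite tree_act_id;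
      exact: tree_eq_refl.
  apply: funext => a; rewrite /freeze; case: ltnP => // am.
  by rewrite levy_perm_neq // neq_ltn (leq_trans mn am) orbT.
- by rewrite fid tree_act_id; exact: tree_eq_refl.
- rewrite freeze_comp; last by move=> a; exact: levy_group_tag.
  by rewrite tree_act_comp; apply: tree_eq_trans (tree_act_eq _ IHh) IHg.
- apply: tree_eq_trans (tree_act_eq _ (tree_eq_sym IHg)) _.
  rewrite -tree_act_comp -freeze_comp; last by move=> a; exact: levy_group_tag.
  have -> : h \o g = id by apply: funext.
  by rewrite fid tree_act_id; exact: tree_eq_refl.
Qed.

(* Finite supports only matter through the finite set of blocks they meet. *)
Lemma tree_symmetricE t : tree_symmetric levy_group t <->
  exists m, forall j, m <= j -> tree_eq (tree_act (levy_perm j) t) t.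
Proof.
split=> [[E HE]|[m Ht]].
  (* This bound lies beyond every block that meets [E]. *)
  exists (\max_(a <- E) (tag a).+1) => j lej; apply: HE.
    by apply: generated_gen; exists j.
  move=> a aE; apply: levy_perm_neq; rewrite neq_ltn (leq_trans _ lej) //.
  exact: (leq_bigmax_seq (F := fun a : levy_atom => (tag a).+1)).
(* One atom per block suffices: an element of the group fixing the first [m] heads fixes those
   blocks pointwise, hence equals its frozen version. *)
exists [seq block_head i | i <- iota 0 m] => g Gg gE.
suff <- : freeze m g = g by exact: tree_act_freeze.
apply: funext => a; rewrite /freeze; case: ifP => // am.
apply/esym/levy_group_fix => //; apply: gE; apply: map_f.
by rewrite mem_iota.
Qed.

(** As the generators commute, the same bound [m] serves the moved tree. *)
Lemma tree_symmetric_act j t :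
  tree_symmetric levy_group t -> tree_symmetric levy_group (tree_act (levy_perm j) t).
Proof.
move=> /tree_symmetricE[m Ht]; apply/tree_symmetricE; exists m => i mi.
by rewrite -tree_act_comp levy_permC tree_act_comp; apply: tree_act_eq; exact: Ht.
Qed.

Lemma tree_hsymmetric_act j t :
  tree_hsymmetric levy_group t -> tree_hsymmetric levy_group (tree_act (levy_perm j) t).
Proof.
elim: t => [a|J f IH] /= [St Hf]; split=> //; try exact: (tree_symmetric_act j St).
by move=> i; exact: IH.
Qed.

(** * Levy's model *)

Local Notation M := levy_model.
Local Notation hsym := (tree_hsymmetric levy_group).

Definition tree_class (A : Type) (t : tree A) : hierarchy A :=
  exist _ (tree_eq t) (ex_intro _ t erefl).

Definition levy_set (t : tree levy_atom) (Ht : hsym t) : M :=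
  exist _ (tree_class t) (ex_intro2 _ _ t (tree_eq_refl t) Ht).

(** A sigma type, so that a hereditarily symmetric representative can be projected out; classical
    description provides it. *)
Lemma levy_setP (x : M) : {t & {Ht : hsym t | x = levy_set Ht}}.
Proof.
case: x => -[C HC] HS; have [t Ct Ht] := cid2 HS.
exists t, Ht; apply: eq_exist; apply: eq_exist.
case: (HC) => s E; have {Ct} st : tree_eq s t by rewrite -E.
rewrite E; apply: funext => r; apply: propext.
by split; apply: tree_eq_trans; [exact: tree_eq_sym|].
Qed.

Definition levy_tree (x : M) : tree levy_atom := projT1 (levy_setP x).
Definition levy_treeP (x : M) : hsym (levy_tree x) :=
    proj1_sig (projT2 (levy_setP x)).

Lemma levy_treeK (x : M) : levy_set (levy_treeP x) = x.
Proof. exact/esym/(proj2_sig (projT2 (levy_setP x))). Qed.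

Lemma levy_set_eq s t (Hs : hsym s) (Ht : hsym t) : levy_set Hs = levy_set Ht <-> tree_eq s t.
Proof.
split=> [E|st].
  have -> : tree_eq s = tree_eq t by case: E.
  exact: tree_eq_refl.
apply: eq_exist; apply: eq_exist; apply: funext => r; apply: propext.
by split; apply: tree_eq_trans => //; exact: tree_eq_sym.
Qed.

Lemma levy_set_elem s t (Hs : hsym s) (Ht : hsym t) : levy_set Hs ∈ levy_set Ht <-> tree_mem s t.
Proof.
split=> [[s' [t' [ss' tt']]]|st].
  by apply: tree_mem_eq; exact: tree_eq_sym.
by exists s, t; split=> //; exact: tree_eq_refl.
Qed.

Lemma levy_tree_eq x y : x = y <-> tree_eq (levy_tree x) (levy_tree y).
Proof. by rewrite -(levy_set_eq (levy_treeP x) (levy_treeP y)) !levy_treeK. Qed.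

Lemma levy_tree_elem (x y : M) : x ∈ y <-> tree_mem (levy_tree x) (levy_tree y).
Proof. by rewrite -(levy_set_elem (levy_treeP x) (levy_treeP y)) !levy_treeK. Qed.

Lemma levy_tree_set t (Ht : hsym t) : tree_eq (levy_tree (levy_set Ht)) t.
Proof. by apply/(levy_set_eq (levy_treeP _) Ht); rewrite levy_treeK. Qed.

Lemma levy_atomE (x : M) : atom x <-> exists a, tree_eq (levy_tree x) (Leaf a).
Proof.
by rewrite -{1}(levy_treeK x).
Qed.

(** * The generators as automorphisms of the model *)

Definition levy_act j (x : M) : M := levy_set (tree_hsymmetric_act j (levy_treeP x)).

Lemma levy_tree_act j x : tree_eq (levy_tree (levy_act j x)) (tree_act (levy_perm j) (levy_tree x)).
Proof. exact: levy_tree_set. Qed.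

Lemma levy_actC i j x : levy_act i (levy_act j x) = levy_act j (levy_act i x).
Proof.
apply/levy_tree_eq.
apply: tree_eq_trans (levy_tree_act _ _) _.
apply: tree_eq_trans (tree_act_eq _ (levy_tree_act _ _)) _.
rewrite -tree_act_comp levy_permC tree_act_comp; apply: tree_eq_sym.
apply: tree_eq_trans (levy_tree_act _ _) _.
exact: (tree_act_eq _ (levy_tree_act _ _)).
Qed.

Lemma levy_tree_iter_act j n x :
  tree_eq (levy_tree (iter n (levy_act j) x)) (tree_act (iter n (levy_perm j)) (levy_tree x)).
Proof.
elim: n => [|n IH] /=; first by rewrite (tree_act_id (levy_tree x));
    exact: tree_eq_refl.
apply: tree_eq_trans (levy_tree_act _ _) _.
apply: tree_eq_trans (tree_act_eq _ IH) _.
by rewrite -tree_act_comp; exact: tree_eq_refl.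
Qed.

Lemma levy_act_order j x : iter (nth_prime j) (levy_act j) x = x.
Proof.
apply/levy_tree_eq; apply: tree_eq_trans (levy_tree_iter_act _ _ _) _.
rewrite (funext (levy_perm_order j)).
by rewrite (tree_act_id (levy_tree x)); exact: tree_eq_refl.
Qed.

(** Written as a power of the generator, the inverse inherits every closure property of [levy_act j]
    by iteration. *)
Definition levy_act_inv j := iter (nth_prime j).-1 (levy_act j).

Lemma levy_actK j : cancel (levy_act j) (levy_act_inv j).
Proof.
by move=> x; rewrite /levy_act_inv -iterSr prednK ?prime_gt0 ?nth_prime_prime // levy_act_order.
Qed.

Lemma levy_act_invK j : cancel (levy_act_inv j) (levy_act j).
Proof.
by move=> x; rewrite /levy_act_inv -iterS prednK ?prime_gt0 ?nth_prime_prime // levy_act_order.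
Qed.

Lemma levy_act_elem_homo j (x y : M) : x ∈ y -> levy_act j x ∈ levy_act j y.
Proof.
rewrite !levy_tree_elem => /(tree_act_mem (levy_perm j)).
by apply: tree_mem_eq; apply: tree_eq_sym; exact: levy_tree_act.
Qed.

Lemma levy_act_inv_elem_homo j (x y : M) : x ∈ y ->
  levy_act_inv j x ∈ levy_act_inv j y.
Proof.
by rewrite /levy_act_inv; elim: _.-1 => [//|n IH] /IH /=; exact: levy_act_elem_homo.
Qed.

Lemma levy_act_elem j (x y : M) : levy_act j x ∈ levy_act j y <-> x ∈ y.
Proof.
by split=> [/(levy_act_inv_elem_homo j)|];
    [rewrite !levy_actK|exact: levy_act_elem_homo].
Qed.

Lemma levy_act_atom_homo j (x : M) : atom x -> atom (levy_act j x).
Proof.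
rewrite !levy_atomE => -[a /(tree_act_eq (levy_perm j))/= xa];
    exists (levy_perm j a).
exact: tree_eq_trans (levy_tree_act _ _) xa.
Qed.

Lemma levy_act_atom j (x : M) : atom (levy_act j x) <-> atom x.
Proof.
split; last exact: levy_act_atom_homo.
rewrite -{2}(levy_actK j x) /levy_act_inv.
by elim: _.-1 => [//|n IH] /IH /=; exact: levy_act_atom_homo.
Qed.

(** Finite support, expressed by a bound on the indices of the blocks involved. *)
Definition supported m (x : M) : Prop := forall j, m <= j -> levy_act j x = x.

Lemma tree_hsymmetric_symmetric t : hsym t -> tree_symmetric levy_group t.
Proof. by case: t => [a|J f] []. Qed.

Lemma supported_exists (x : M) : exists m, supported m x.
Proof.
have /tree_symmetricE[m Hm] := tree_hsymmetric_symmetric (levy_treeP x).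
exists m => j mj; apply/levy_tree_eq; apply: tree_eq_trans (levy_tree_act _ _) _.
exact: Hm.
Qed.

Lemma supported_le m n x : m <= n -> supported m x -> supported n x.
Proof. by move=> mn Sx j nj; apply: Sx; exact: leq_trans nj. Qed.

Lemma levy_is_setE (x : M) : is_set x -> exists (J : Type) (F : J -> M),
  (forall y, y ∈ x <-> exists j, y = F j) /\ tree_eq (levy_tree x) (Node (fun j => levy_tree (F j))).
Proof.
rewrite /is_set levy_atomE; move: (levy_treeP x) (levy_treeK x).
case: (levy_tree x) => [a|J f] H E nA; first by case: nA; exists a.
have Hf i : hsym (f i) by case: (H) => _ /(_ i).
exists J, (fun i => levy_set (Hf i)); split; last first.
  by split=> i; exists i; [apply: tree_eq_sym|apply: tree_eq_sym];
      exact: levy_tree_set.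
move=> y; rewrite -E -(levy_treeK y) levy_set_elem.
by split=> -[i yi]; exists i; [apply/levy_set_eq|move/levy_set_eq: yi].
Qed.

Lemma levy_ext (x y : M) : is_set x -> is_set y -> (forall z, z ∈ x <-> z ∈ y) ->
  x = y.
Proof.
move=> /levy_is_setE[J [F [HF xF]]] /levy_is_setE[K [G [HG yG]]] xy;
    apply/levy_tree_eq.
apply: tree_eq_trans xF _; apply: tree_eq_trans (tree_eq_sym yG).
split=> i.
  by have /xy/HG[j ->] : F i ∈ x by [apply/HF; exists i]; exists j;
      exact: tree_eq_refl.
by have /xy/HF[j ->] : G i ∈ y by [apply/HG; exists i]; exists j;
    exact: tree_eq_refl.
Qed.

(** The source of all sets built in the model: [P] is any predicate of the metatheory that is small,
    being covered by [F], and closed under almost all generators. Its extension is a symmetric node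
    whose children already belong to the model. *)
Lemma levy_comprehension (J : Type) (F : J -> M) (P : M -> Prop) m :
  (forall x, P x -> exists j, x = F j) ->
  (forall j x, m <= j -> P x -> P (levy_act j x)) ->
  exists b : M, [/\ is_set b, forall x, x ∈ b <-> P x & supported m b].
Proof.
move=> PF Pact.
pose t := Node (fun j : {j | P (F j)} => levy_tree (F (sval j))).
have act_t k : m <= k -> tree_eq (tree_act (levy_perm k) t) t.
  move=> mk; split=> -[j Pj] /=.
    have [i E] := PF _ (Pact _ _ mk Pj).
    have Pi : P (F i) by rewrite -E; exact: Pact.
    by exists (exist _ i Pi) => /=; rewrite -E; apply: tree_eq_sym;
        exact: levy_tree_act.
  (* Closure under the generator gives closure under its inverse, which is one of its powers. *)
  have Pinv : P (levy_act_inv k (F j)).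
    by rewrite /levy_act_inv; elim: _.-1 => [//|n IH] /=; exact: Pact.
  have [i E] := PF _ Pinv; have Pi : P (F i) by rewrite -E.
  exists (exist _ i Pi) => /=; rewrite -E.
  by apply: tree_eq_trans (tree_eq_sym (levy_tree_act _ _)) _;
      rewrite levy_act_invK; exact: tree_eq_refl.
have Ht : hsym t.
  by split=> [|[j Pj]]; [apply/tree_symmetricE; exists m|exact: levy_treeP].
exists (levy_set Ht); split.
- case/levy_atomE=> a /(tree_eq_trans (tree_eq_sym (levy_tree_set Ht))).
  by [].
- move=> x; rewrite -{1}(levy_treeK x) levy_set_elem;
    split=> [[[j Pj]] /= /levy_tree_eq->//|Px].
  have [j E] := PF _ Px; have Pj : P (F j) by rewrite -E.
  by exists (exist _ j Pj); rewrite /= E; exact: tree_eq_refl.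
- move=> k mk; apply/levy_tree_eq; apply: tree_eq_trans (levy_tree_act _ _) _.
  apply: tree_eq_trans (tree_act_eq _ (levy_tree_set _)) _.
  exact: tree_eq_trans (act_t _ mk) (tree_eq_sym (levy_tree_set Ht)).
Qed.

Lemma levy_foundation (x : M) : (exists z, z ∈ x) ->
  exists2 y, y ∈ x & forall z, z ∈ x -> ~ z ∈ y.
Proof.
case=> z zx; apply: contrapT => nmin.
(* The induction runs over a tree merely bisimilar to the representative of [y], since
   representatives of members need not be subtrees. *)
suff H t (y : M) : tree_eq (levy_tree y) t ->
  ~ y ∈ x by exact: (H _ z (tree_eq_refl _)).
elim: t y => [a|J f IH] y yt yx; apply: nmin; exists y => // u ux /levy_tree_elem.
  by case: (levy_tree y) yt.
case: (levy_tree y) yt => [//|K g] [gf _] [k uk]; have [j gfk] := gf k.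
exact: (IH j u (tree_eq_trans uk gfk)).
Qed.

Lemma hsym_Leaf a : hsym (Leaf a).
Proof.
split=> //; apply/tree_symmetricE; exists (tag a).+1 => j aj /=.
by rewrite levy_perm_neq // neq_ltn aj.
Qed.

Definition levy_of_atom (a : levy_atom) : M := levy_set (hsym_Leaf a).

Lemma levy_atomP (x : M) : atom x <-> exists a, x = levy_of_atom a.
Proof.
rewrite levy_atomE; split=> -[a xa]; exists a.
  by rewrite -(levy_treeK x); apply/levy_set_eq.
by rewrite xa; exact: levy_tree_set.
Qed.

Lemma levy_of_atom_inj : injective levy_of_atom.
Proof. by move=> a b /levy_set_eq. Qed.

Lemma levy_act_of_atom j a : levy_act j (levy_of_atom a) = levy_of_atom (levy_perm j a).
Proof.
apply/levy_tree_eq; apply: tree_eq_trans (levy_tree_act _ _) _.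
apply: tree_eq_trans (tree_act_eq _ (levy_tree_set _)) _.
exact/tree_eq_sym/levy_tree_set.
Qed.

Lemma levy_atom_empty (a x : M) : atom a -> ~ x ∈ a.
Proof. by case/levy_atomP=> b ->; rewrite -(levy_treeK x) levy_set_elem. Qed.

Lemma levy_act_is_set j (x : M) : is_set (levy_act j x) <-> is_set x.
Proof. by rewrite /is_set levy_act_atom. Qed.

Lemma sat_levy_act j p (e : nat -> M) : sat (levy_act j \o e) p <-> sat e p.
Proof.
have cons x e' : levy_act j \o env_cons x e' = env_cons (levy_act j x) (levy_act j \o e').
  by apply: funext; case.
elim: p e => [i k|i k|i|p IH|p IHp q IHq|p IHp q IHq|p IHp q IHq|p IH|p IH] e /=.
- by split=> [/(can_inj (levy_actK j))|->].
- exact: levy_act_elem.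
- exact: levy_act_atom.
- by rewrite IH.
- by rewrite IHp IHq.
- by rewrite IHp IHq.
- by rewrite IHp IHq.
- split=> H x; first by apply/IH; rewrite cons; exact: H.
  by rewrite -(levy_act_invK j x) -cons; apply/IH; exact: H.
- split=> -[x H]; last by exists (levy_act j x); rewrite -cons; apply/IH.
  by exists (levy_act_inv j x); apply/IH; rewrite cons levy_act_invK.
Qed.

(** An environment has infinitely many entries and possibly no common support; a formula reads only
    finitely many of them. *)
Lemma sat_bounded (N : structure) p : exists k, forall e e' : nat -> N,
  (forall i, i < k -> e i = e' i) -> sat e p = sat e' p.
Proof.
have cons k (e e' : nat -> N) x : (forall i, i < k -> e i = e' i) ->
  forall i, i < k.+1 -> env_cons x e i = env_cons x e' i by move=> H [|i] //=;
      exact: H.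
have join p1 q k l (Q : forall (e e' : nat -> N), Prop) :
    (forall e e' : nat -> N, (forall i, i < k -> e i = e' i) ->
      sat e p1 = sat e' p1) ->
    (forall e e' : nat -> N, (forall i, i < l -> e i = e' i) ->
      sat e q = sat e' q) ->
    (forall e e', sat e p1 = sat e' p1 -> sat e q = sat e' q -> Q e e') ->
    exists n, forall e e' : nat -> N, (forall i, i < n -> e i = e' i) -> Q e e'.
  move=> Hp Hq HQ; exists (maxn k l) => e e' H; apply: HQ;
      [apply: Hp|apply: Hq] => i Hi.
    by apply: H; rewrite leq_max Hi.
  by apply: H; rewrite leq_max Hi orbT.
elim: p => [i j|i j|i|p [k IH]|p [k IHp] q [l IHq]|p [k IHp] q [l IHq]|p [k IHp] q [l IHq]|p [k IH]|p [k IH]].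
- exists (maxn i j).+1 => e e' H /=; rewrite !H // ltnS leq_max leqnn ?orbT //.
- exists (maxn i j).+1 => e e' H /=; rewrite !H // ltnS leq_max leqnn ?orbT //.
- by exists i.+1 => e e' H /=; rewrite H.
- by exists k => e e' H /=; rewrite (IH e e').
- by apply: join IHp IHq _ => e e' /= -> ->.
- by apply: join IHp IHq _ => e e' /= -> ->.
- by apply: join IHp IHq _ => e e' /= -> ->.
- exists k => e e' H /=; apply: eq_forall => x; apply: IH => i Hi.
  exact: (cons _ _ _ x H i (leqW Hi)).
- exists k => e e' H /=; apply: eq_exists => x; apply: IH => i Hi.
  exact: (cons _ _ _ x H i (leqW Hi)).
Qed.

Lemma env_supported (e : nat -> M) k : exists m, forall i, i < k ->
  supported m (e i).
Proof.
elim: k => [|k [m Hm]]; first by exists 0.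
have [n Hn] := supported_exists (e k); exists (maxn m n) => i.
rewrite ltnS leq_eqVlt => /orP[/eqP->|/Hm]; last by apply: supported_le;
    exact: leq_maxl.
by apply: supported_le Hn; exact: leq_maxr.
Qed.

(** Generators are automorphisms, and those of large index fix the finitely many parameters that [p]
    reads. *)
Lemma sat_supported p (e : nat -> M) : exists m, forall j x y, m <= j ->
  sat (env_cons x (env_cons y e)) p ->
  sat (env_cons (levy_act j x) (env_cons (levy_act j y) e)) p.
Proof.
have [k Hk] := sat_bounded M p; have [m Hm] := env_supported e k.
exists m => j x y mj /(sat_levy_act j).
rewrite (Hk _ (env_cons (levy_act j x) (env_cons (levy_act j y) e))) // =>
    -[|[|i]] //= ik.
by apply: (Hm i) => //; exact: ltnW (ltnW _).
Qed.

Lemma sat_supported1 p (e : nat -> M) : exists m, forall j x, m <= j ->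
  sat (env_cons x e) p -> sat (env_cons (levy_act j x) e) p.
Proof.
have [k Hk] := sat_bounded M p; have [m Hm] := env_supported e k.
exists m => j x mj /(sat_levy_act j).
rewrite (Hk _ (env_cons (levy_act j x) e)) // => -[|i] //= ik.
by apply: (Hm i) => //; exact: ltnW.
Qed.

(** * Set constructions in the model *)

Lemma supported_elem m j (x a : M) : supported m a -> m <= j -> x ∈ a ->
  levy_act j x ∈ a.
Proof. by move=> Sa mj xa; rewrite -(Sa j mj); apply/levy_act_elem. Qed.

Lemma levy_pair (a b : M) : exists p, is_upair p a b.
Proof.
have [m Ha] := supported_exists a; have [n Hb] := supported_exists b.
have [|j x mj|p [sp Hp _]] := @levy_comprehension bool (fun i =>
    if i then a else b) (fun z => z = a \/ z = b) (maxn m n).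
- by move=> x [->|->]; [exists true|exists false].
- by move: mj; rewrite geq_max => /andP[mj nj] [->|->]; [left; exact: Ha|right;
    exact: Hb].
- by exists p.
Qed.

Lemma levy_small (x : M) : exists (J : Type) (F : J ->
  M), forall y, y ∈ x <-> exists j, y = F j.
Proof.
have [ax|/levy_is_setE[J [F [HF _]]]] := lem (atom x); last by exists J, F.
by exists void, (fun v : void => match v with end) => z;
    split=> [/(levy_atom_empty ax)|[[]]].
Qed.

Definition levy_index (x : M) : Type := sval (cid (levy_small x)).
Definition levy_child (x : M) : levy_index x ->
  M := sval (cid (svalP (cid (levy_small x)))).

Lemma levy_childP (x y : M) : y ∈ x <-> exists j : levy_index x, y = levy_child j.
Proof. exact: (svalP (cid (svalP (cid (levy_small x))))). Qed.

Lemma levy_separation (a : M) (P : M -> Prop) m : supported m a ->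
  (forall j x, m <= j -> P x -> P (levy_act j x)) ->
  exists b : M, [/\ is_set b, forall x, x ∈ b <-> x ∈ a /\ P x & supported m b].
Proof.
move=> Sa Pact; apply: (@levy_comprehension _ (@levy_child a)).
  by move=> x [/levy_childP].
by move=> j x mj [xa /(Pact _ _ mj) Px]; split=> //; exact: supported_elem Sa mj xa.
Qed.

Lemma levy_empty : exists x : M, is_empty x.
Proof.
have [||x [sx Hx _]] := @levy_comprehension void (fun v : void =>
    match v with end) (fun=> False) 0 => //.
by exists x; split=> // z /Hx.
Qed.

Lemma levy_union (x : M) : exists u, is_union u x.
Proof.
have [m Sx] := supported_exists x.
have [||u [su Hu _]] := @levy_comprehension {i : levy_index x & levy_index (levy_child i)}
    (fun i => levy_child (projT2 i)) (fun z => exists2 y, y ∈ x & z ∈ y) m;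
        last by exists u.
  by move=> z [y /levy_childP[i ->] /levy_childP[k ->]]; exists (existT _ i k).
move=> j z mj [y yx zy]; exists (levy_act j y);
    first exact: supported_elem Sx mj yx.
exact/levy_act_elem.
Qed.

Lemma levy_power (x : M) : exists p, is_power p x.
Proof.
have [m Sx] := supported_exists x.
have [e [se _]] := levy_empty.
(* Predicates on the index type of [x] cover all its subsets. A predicate whose extension is not in
   the model receives the default [e]. *)
have /choice[F HF] (Q : levy_index x -> Prop) : exists z : M,
    (exists2 y, is_set y & forall t, t ∈ y <-> exists2 i, Q i & t = levy_child i) ->
    is_set z /\ forall t, t ∈ z <-> exists2 i, Q i & t = levy_child i.
  have [[y sy Hy]|nQ] := lem (exists2 y, is_set y & forall t,
      t ∈ y <-> exists2 i, Q i & t = levy_child i).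
    by exists y.
  by exists e.
have [||p [sp Hp _]] := @levy_comprehension _ F (fun z =>
    is_set z /\ incl z x) m; last by exists p.
  move=> z [sz zx]; exists (fun i => levy_child i ∈ z).
  have Hz t : t ∈ z <-> exists2 i : levy_index x,
      levy_child i ∈ z & t = levy_child i.
    split=> [tz|[i iz ->]//]; have [i E] := proj1 (levy_childP _ _) (zx _ tz).
    by exists i; rewrite -?E.
  have [|sF HFz] := HF (fun i => levy_child i ∈ z); first by exists z.
  by apply: levy_ext => // t; rewrite Hz HFz.
move=> j z mj [sz zx]; split; first exact/levy_act_is_set.
move=> t; rewrite -(levy_act_invK j t) levy_act_elem => /zx tx.
exact: supported_elem Sx mj tx.
Qed.

Lemma levy_adjunction (x a : M) : exists y, is_set y /\ is_adjunction y x a.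
Proof.
have [m Sx] := supported_exists x; have [n Sa] := supported_exists a.
have [||y [sy Hy _]] := @levy_comprehension (option (levy_index x))
  (fun i => if i is Some i then levy_child i else a) (fun z =>
      z ∈ x \/ z = a) (maxn m n); last by exists y.
  by move=> z [/levy_childP[i ->]|->]; [exists (Some i)|exists None].
move=> j z; rewrite geq_max => /andP[mj nj] [zx|->]; last by right; exact: Sa.
by left; exact: supported_elem Sx mj zx.
Qed.

(** * Numerals and the axioms *)

Fixpoint levy_nat n : M :=
  if n is k.+1 then sval (cid (levy_adjunction (levy_nat k) (levy_nat k))) else sval (cid levy_empty).

Lemma levy_nat_succ n : is_succ (levy_nat n.+1) (levy_nat n).
Proof. exact: (svalP (cid (levy_adjunction (levy_nat n) (levy_nat n)))). Qed.

Lemma levy_nat_elem n x : x ∈ levy_nat n <-> exists2 k, k < n & x = levy_nat k.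
Proof.
elim: n => [|n IH]; first by split=> [|[]//];
    case: (svalP (cid levy_empty)) => _ /(_ x).
have [_ ->] := levy_nat_succ n; rewrite IH; split.
  by case=> [[k kn ->]|->]; [exists k => //; exact: leqW|exists n].
by case=> k; rewrite ltnS leq_eqVlt => /orP[/eqP->|kn] ->; [right|left; exists k].
Qed.

Lemma levy_empty_nat z : is_empty z <-> z = levy_nat 0.
Proof.
have [s0 e0] : is_empty (levy_nat 0) := svalP (cid levy_empty).
split=> [[sz ez]|->//]; apply: levy_ext => // t; split; first by move/ez.
by move/e0.
Qed.

Lemma levy_succ_nat s n : is_succ s (levy_nat n) <-> s = levy_nat n.+1.
Proof.
split=> [[ss Hs]|->]; last exact: levy_nat_succ.
have [sn Hn] := levy_nat_succ n.
by apply: levy_ext => // t; rewrite Hs Hn.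
Qed.

Lemma levy_act_nat j n : levy_act j (levy_nat n) = levy_nat n.
Proof.
elim: n => [|n IH].
  apply/levy_empty_nat; have [s0 e0] := proj2 (levy_empty_nat _) erefl.
  split; first exact/levy_act_is_set.
  by move=> z; rewrite -(levy_act_invK j z) levy_act_elem => /e0.
apply/levy_succ_nat; have [sn Hn] := levy_nat_succ n.
split; first exact/levy_act_is_set.
move=> z; rewrite -(levy_act_invK j z) levy_act_elem Hn;
    move: (levy_act_inv j z) => y.
have := levy_act_elem j y (levy_nat n); rewrite IH => ->.
by split=> -[|E]; [left|right; rewrite E|left|right;
    apply: (can_inj (levy_actK j)); rewrite IH].
Qed.

Lemma levy_omega_set : exists w : M, is_set w /\ forall x, x ∈ w <-> exists n,
    x = levy_nat n.
Proof.
have [//||w [sw Hw _]] := @levy_comprehension _ levy_nat (fun x =>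
    exists n, x = levy_nat n) 0; last by exists w.
by move=> j x _ [n ->]; exists n; exact: levy_act_nat.
Qed.

Lemma levy_ZFA : ZFA M.
Proof.
split.
- exact: levy_atom_empty.
- have [||A [sA HA _]] := @levy_comprehension _ levy_of_atom (@atom M) 0;
    last by exists A.
    by move=> x /levy_atomP.
  by move=> j x _ /levy_act_atom.
- exact: levy_empty.
- exact: levy_ext.
- exact: levy_pair.
- by move=> x _; exact: levy_union.
- by move=> x _; exact: levy_power.
- have [w [sw Hw]] := levy_omega_set; exists w; split=> //.
    by move=> z /levy_empty_nat->; apply/Hw; exists 0.
  by move=> n s /Hw[k ->] /levy_succ_nat->; apply/Hw; exists k.+1.
- move=> p e a sa; have [m Hm] := sat_supported1 p e;
    have [n Sa] := supported_exists a.
  have [||b [sb Hb _]] := @levy_separation a (fun x =>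
      sat (env_cons x e) p) (maxn m n); last by exists b.
    by apply: supported_le Sa; rewrite leq_maxr.
  by move=> j x; rewrite geq_max => /andP[mj _]; exact: Hm.
- move=> p e a sa pfun; have [m Hm] := sat_supported p e;
    have [n Sa] := supported_exists a.
  (* External choice turns the functional relation into a map covering the image; [a] is the default
     where there is no value. *)
  have /choice[F HF] (i : levy_index a) : exists y : M,
      (exists z, sat (env_cons (levy_child i) (env_cons z e)) p) ->
      sat (env_cons (levy_child i) (env_cons y e)) p.
    have [[y Hy]|nE] := lem (exists z, sat (env_cons (levy_child i) (env_cons z e)) p); first by exists y.
    by exists a.
  have [||b [sb Hb _]] := @levy_comprehension _ F
      (fun y => exists2 x, x ∈ a & sat (env_cons x (env_cons y e)) p) (maxn m n);
          last by exists b.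
    move=> y [x xa]; case/levy_childP: (xa) => i E; rewrite E in xa * => Hy.
    by exists i; exact: (pfun _ _ _ xa Hy (HF i (ex_intro _ y Hy))).
  move=> j y; rewrite geq_max => /andP[mj nj] [x xa Hx].
  by exists (levy_act j x); [exact: supported_elem Sa nj xa|exact: Hm].
- exact: levy_foundation.
Qed.

Local Notation ZM := levy_ZFA.

(** The model has standard natural numbers: the set of numerals is an inductive set of the model, so
    it contains the least one. *)
Lemma levy_in_omega (x : M) : in_omega x <-> exists n, x = levy_nat n.
Proof.
have [w [[sw w0 wS] wmin]] := omega_exists ZM.
rewrite (in_omegaE ZM (w := w)); last by split.
split=> [xw|[n ->]].
  have [W [sW HW]] := levy_omega_set; apply/HW; apply: wmin xw; split=> //.
    by move=> z /levy_empty_nat->; apply/HW; exists 0.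
  by move=> n s /HW[k ->] /levy_succ_nat->; apply/HW; exists k.+1.
elim: n => [|n IH]; first exact/w0/levy_empty_nat.
exact: wS IH (levy_nat_succ n).
Qed.

Lemma levy_nat_inj : injective levy_nat.
Proof.
have H i j : i < j -> levy_nat i <> levy_nat j.
  move=> ij E; apply: (@elem_irrefl _ ZM (levy_nat j)); rewrite -{1}E.
  by apply/levy_nat_elem; exists i.
by move=> i j E; case: (ltngtP i j) => // /H; [case|case; rewrite E].
Qed.

(** * External sequences and functions of the model *)

Lemma upair_act j (p a b : M) : is_upair p a b ->
  is_upair (levy_act j p) (levy_act j a) (levy_act j b).
Proof.
case=> sp Hp; split; first exact/levy_act_is_set.
move=> z; rewrite -(levy_act_invK j z) levy_act_elem Hp.
by split=> -[E|E]; [left|right|left|right]; rewrite ?E //;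
    apply: (can_inj (levy_actK j)).
Qed.

Lemma opair_act j (p a b : M) : is_opair p a b ->
  is_opair (levy_act j p) (levy_act j a) (levy_act j b).
Proof. by case=> u [v [Hu Hv Hp]]; exists (levy_act j u), (levy_act j v); split;
    exact: upair_act. Qed.

Lemma maps_act j (f x y : M) : maps f x y ->
  maps (levy_act j f) (levy_act j x) (levy_act j y).
Proof. by case=> p Hp pf; exists (levy_act j p);
    [exact: opair_act|apply/levy_act_elem]. Qed.

(** A generator fixing the bijection with ω, and every numeral, must fix each member of [X]. So one
    bound supports all members. *)
Lemma denumerable_enum (X : M) : denumerable X -> exists m (x : nat -> M),
  [/\ forall z, z ∈ X <-> exists n, z = x n, injective x & forall n,
      supported m (x n)].
Proof.
case=> sX [w Hw [f [Ff finj fsur]]]; have [m Sf] := supported_exists f.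
have wE z : z ∈ w <-> exists n, z = levy_nat n by rewrite -levy_in_omega (in_omegaE ZM Hw).
have /choice[x Hx] n : exists z, maps f z (levy_nat n) by apply: fsur; apply/wE;
    exists n.
exists m, x; split.
- move=> z; split=> [zX|[n ->]]; last by case: (function_value Ff (Hx n)).
  have [y /wE[n ->] fzn] := function_total Ff zX.
  by exists n; exact: finj fzn (Hx n).
- move=> i j E; apply: levy_nat_inj; apply: (function_fun Ff (Hx i)); rewrite E;
    exact: Hx.
- move=> n j mj; apply: finj (Hx n); have := maps_act j (Hx n).
  by rewrite Sf // levy_act_nat.
Qed.

(** A common support bound is all that an externally chosen sequence of values needs to form a
    function of the model. *)
Lemma levy_function (x y : nat -> M) (X Y : M) m : injective x ->
  (forall n, supported m (x n)) -> (forall n, supported m (y n)) ->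
  (forall z, z ∈ X <-> exists n, z = x n) -> (forall n, y n ∈ Y) ->
  exists f, is_function f X Y /\ forall a b, maps f a b <-> exists n,
      a = x n /\ b = y n.
Proof.
move=> xinj Sx Sy HX HY.
have /choice[F HF] n : exists p, is_opair p (x n) (y n) by exact: (opair_exists ZM).
have [||f [sf Hf _]] := @levy_comprehension _ F (fun p =>
    exists n, is_opair p (x n) (y n)) m.
- by move=> p [n Hp]; exists n; exact: (opair_unique ZM Hp (HF n)).
- by move=> j p mj [n /(opair_act j)]; rewrite Sx // Sy // => Hp; exists n.
have mapsE a b : maps f a b <-> exists n, a = x n /\ b = y n.
  split=> [[p pab /Hf[n pn]]|[n [-> ->]]]; first by exists n;
      exact: (opair_inj pab pn).
  by exists (F n) => //; apply/Hf; exists n.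
exists f; split=> //; split=> //.
- by move=> p /Hf[n Hp]; exists (x n), (y n); split=> //; apply/HX; exists n.
- move=> a /HX[n ->]; exists (y n); split; first by apply/mapsE; exists n.
  by move=> b /mapsE[k [/xinj-> ->]].
Qed.

Lemma levy_finite (T : finType) (F : T -> M) (a : M) : is_set a ->
  (forall x, x ∈ a -> exists t, x = F t) -> finite_set a.
Proof.
move=> sa Ha; have [w Hw] := omega_exists ZM.
have [b [Fb Hb]] : exists b : M, finite_set b /\ forall t, t \in enum T -> F t ∈ b.
  elim: (enum T) => [|t s [b [Fb Hb]]].
    have [e He] := empty_exists ZM; exists e; split=> //;
        exact: (finite_set_empty ZM Hw He).
  have [c [sc Hc]] := adjunction_exists ZM (F t) (proj1 Fb).
  exists c; split; first exact: (finite_set_adjunction ZM Hw Fb sc Hc).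
  by move=> u; rewrite inE => /orP[/eqP->|/Hb]; rewrite Hc; [right|left].
apply: (finite_set_sub ZM Hw Fb sa) => x /Ha[t ->]; apply: Hb.
by rewrite mem_enum.
Qed.

Lemma iter_levy_actC i j c z : levy_act j (iter c (levy_act i) z) = iter c (levy_act i) (levy_act j z).
Proof. by elim: c => [//|c IH]; rewrite !iterS levy_actC IH. Qed.

(** The orbit of [z] under the generators from [m] on. Only finitely many of them move [z], and each
    has finite order. *)
Lemma levy_orbit m (z : M) : exists y, [/\ finite_set y, z ∈ y, supported m y &
  forall a : M, supported m a -> z ∈ a -> incl y a].
Proof.
have [m' Sz] := supported_exists z.
have {}Sz : supported (m + m') z by apply: supported_le Sz; exact: leq_addl.
suff [y [T [F [HF sy zy Sy ymin]]]] : exists (y : M) (T : finType) (F : T -> M),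
    [/\ forall x, x ∈ y -> exists t, x = F t, is_set y, z ∈ y, supported m y &
      forall a : M, supported m a -> z ∈ a -> incl y a].
  by exists y; split=> //; exact: levy_finite HF.
(* Induction on the number of generators, from [m] on, that may move [z]. *)
elim: m' m Sz => [|d IH] m Sz.
  have [||y [sy Hy Sy]] := @levy_comprehension unit (fun=> z) (fun x => x = z) m.
  - by move=> x ->; exists tt.
  - by move=> j x mj ->; apply: Sz; rewrite addn0.
  exists y, unit, (fun=> z); split=> //; first by move=> x /Hy; exists tt.
    exact/Hy.
  by move=> a _ za x /Hy->.
have [|y0 [T [F [HF sy0 zy0 Sy0 y0min]]]] := IH m.+1; first by rewrite addSnnS.
(* The orbit [y0] for the generators after [m] is closed under powers of generator [m]; exponents
   below its order suffice, so the index type stays finite. *)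
pose G (i : 'I_(nth_prime m) * T) := iter i.1 (levy_act m) (F i.2).
pose P x := exists2 v, v ∈ y0 & exists c, x = iter c (levy_act m) v.
have PG x : P x -> exists i, x = G i.
  case=> v /HF[t ->] [c ->].
  have pm : c %% nth_prime m < nth_prime m by rewrite ltn_mod prime_gt0 // nth_prime_prime.
  exists (Ordinal pm, t); rewrite /G /= {1}(divn_eq c (nth_prime m)) addnC iterD;
      congr iter.
  elim: (c %/ _) => [//|k IHk]; rewrite mulSn iterD IHk; exact: levy_act_order.
have [//||y [sy Hy Sy]] := @levy_comprehension _ G P m.
  move=> j x; rewrite leq_eqVlt => /orP[/eqP<-|mj] [v vy0 [c ->]].
    by exists v => //; exists c.+1.
  exists (levy_act j v); first exact: supported_elem Sy0 mj vy0.
  by exists c; exact: iter_levy_actC.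
exists y, _, G; split=> //.
- by move=> x /Hy/PG.
- by apply/Hy; exists z => //; exists 0.
- move=> a Sa za x /Hy[v vy0 [c ->]].
  have va : v ∈ a by apply: y0min za _ vy0; apply: supported_le Sa.
  by elim: c => [//|c IHc]; rewrite iterS; exact: supported_elem Sa (leqnn m) IHc.
Qed.

Lemma levy_CMC : CMC M.
Proof.
move=> X DX HX; have [m [x [Xx xinj Sx]]] := denumerable_enum DX.
(* Each [x n] is supported by the common bound [m], so it contains the orbit of any of its members.
   These orbits share the bound [m]. *)
have /choice[y Hy] n : exists y, [/\ finite_set y, exists z, z ∈ y,
    supported m y & incl y (x n)].
  have [|_ [z zx]] := HX (x n); first by apply/Xx; exists n.
  have [y [Fy zy Sy ymin]] := levy_orbit m z.
  by exists y; split=> //; [exists z|exact: ymin].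
have [U HU] := levy_union X; have [P HP] := levy_power U.
have yP n : y n ∈ P.
  have [[sy _] _ _ yx] := Hy n; apply/(proj2 HP); split=> // t ty.
  by apply/(proj2 HU); exists (x n); [apply/Xx; exists n|exact: yx].
have [|f [Ff Hf]] := levy_function xinj Sx _ Xx yP; first by move=> n; case: (Hy n).
exists U, P, f; split=> // a b _ /Hf[n [-> ->]].
by case: (Hy n).
Qed.

(** * Choice from finite sets of bounded size *)

Lemma iter_fix_mul (T : Type) (g : T -> T) z d k : iter d g z = z ->
  iter (k * d) g z = z.
Proof. by move=> H; elim: k => [//|k IH]; rewrite mulSn iterD IH. Qed.

(** Bezout in natural numbers: [u * d = v * p + 1], so [u * d] iterations amount to a single one. *)
Lemma iter_fix_coprime (T : Type) (g : T -> T) z d p : 0 < d -> coprime d p ->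
  iter d g z = z -> iter p g z = z -> g z = z.
Proof.
move=> d0 /eqP cop dz pz; case: (egcdnP p d0) => u v E _.
have := iter_fix_mul u dz; rewrite E cop addn1 iterS.
by rewrite iter_fix_mul.
Qed.

(** An internal bijection read as an external injection into the numbers below [k]. The type
    ['I_k.+1] provides a default value outside [a], even for [k = 0]. *)
Lemma equipotent_nat_index (a : M) k : equipotent a (levy_nat k) ->
  exists h : M -> 'I_k.+1,
  (forall z, z ∈ a -> h z < k) /\ (forall z z', z ∈ a -> z' ∈ a -> h z = h z' ->
    z = z').
Proof.
case/equipotentE=> R _ [tot _ inj].
have /choice[h Hh] z : exists i : 'I_k.+1, z ∈ a -> i < k /\ R z (levy_nat i).
  have [za|za] := lem (z ∈ a); last by exists ord0.
  have [y /levy_nat_elem[i ik ->] Rzi] := tot _ za.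
  by exists (inord i); rewrite inordK // leqW.
exists h; split=> [z /Hh[]//|z z' za z'a E].
have [hk Rz] := Hh _ za; have [_ Rz'] := Hh _ z'a.
rewrite -E in Rz'.
have hza : levy_nat (h z) ∈ levy_nat k by apply/levy_nat_elem; exists (h z).
exact/(inj z z' _ _ za z'a hza hza Rz Rz').
Qed.

(** For [j] at least [m] the iterates of [z] stay in [a], so [z] has a positive period [d] at most
    [k]. The order of generator [j] is a prime above [j], hence above [d], so the two are coprime
    and [z] is fixed. *)
Lemma supported_small m k (a z : M) : supported m a -> k <= m ->
  equipotent a (levy_nat k) -> z ∈ a -> supported m z.
Proof.
move=> Sa km /equipotent_nat_index[h [hk hinj]] za j mj.
have itera i : iter i (levy_act j) z ∈ a.
  by elim: i => [//|i IH]; rewrite iterS; exact: supported_elem Sa mj IH.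
(* Pigeonhole: the iterates number 0 to [k] take at most [k] values. *)
pose r (i : 'I_k.+1) := Ordinal (hk _ (itera i)).
have : ~ injective r by move/leq_card; rewrite !card_ord ltnn.
move=> ninj; apply: contrapT => nz; apply: ninj => i i' [E].
have {E} := hinj _ _ (itera i) (itera i') (val_inj E).
wlog ii' : i i' / i <= i' => [H|].
  by case/orP: (leq_total i i') => /H{}H E; [exact: H|apply/esym/H].
rewrite -(subnKC ii') iterD; set d := i' - i => E.
have dz : iter d (levy_act j) z = z.
  apply/esym; move: E; elim: (nat_of_ord i) => [//|c IH].
  by rewrite !iterS => /(can_inj (@levy_actK j)).
apply: val_inj; apply/eqP; rewrite eqn_leq ii' -subn_eq0 /=;
    apply: contrapT => /negP; rewrite -lt0n => d0.
apply: nz; apply: (iter_fix_coprime d0 _ dz (levy_act_order j z)).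
rewrite coprime_sym prime_coprime ?nth_prime_prime //; apply/negP => /(dvdn_leq d0).
apply/negP; rewrite -ltnNge; apply: leq_ltn_trans (nth_prime_gt j).
apply: leq_trans (leq_subr _ _) _; apply: leq_trans mj; apply: leq_trans km.
by rewrite -ltnS.
Qed.

Lemma levy_C_omega (n : M) : in_omega n -> ge2 n -> C_omega n.
Proof.
case/levy_in_omega=> k -> g2 X DX HX; have [m [x [Xx xinj Sx]]] :=
    denumerable_enum DX.
have [t tk] : exists t, t ∈ levy_nat k.
  case: g2 => [z [o [t [_ _ [_ Ht] [|<-]]]]]; first by exists t.
  by exists o; apply/Ht; right.
(* Any members may be chosen, since beyond [maxn m k] every generator fixes all members of all the
   [x i]. *)
have /choice[y Hy] i : exists y, y ∈ x i /\ supported (maxn m k) y.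
  have [|_ xk] := HX (x i); first by apply/Xx; exists i.
  have [y yx] := equipotent_nonempty (equipotent_sym ZM xk) tk.
  exists y; split=> //; apply: supported_small xk yx; last exact: leq_maxr.
  by apply: supported_le (Sx i); exact: leq_maxl.
have [U HU] := levy_union X.
have Sx' i : supported (maxn m k) (x i) by apply: supported_le (Sx i);
    exact: leq_maxl.
have yU i : y i ∈ U.
  by apply/(proj2 HU); exists (x i); [apply/Xx; exists i|case: (Hy i)].
have [f [Ff Hf]] := levy_function xinj Sx' (fun i => proj2 (Hy i)) Xx yU.
exists U, f; split=> // a b _ /Hf[i [-> ->]].
by case: (Hy i).
Qed.

Lemma levy_not_IDI : ~ IDI M.
Proof.
have [A [sA HA]] := zfa_atoms_set ZM => /(_ A)[].
  split=> // n /levy_in_omega[k ->] /equipotent_nat_index[h [hk hinj]].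
  have inA i : levy_of_atom (block_head i) ∈ A by apply/HA/levy_atomP;
      exists (block_head i).
  (* The heads of the first [k.+1] blocks would inject into [k] values. *)
  pose r (i : 'I_k.+1) := Ordinal (hk _ (inA i)).
  suff /leq_card : injective r by rewrite !card_ord ltnn.
  move=> i j [/val_inj E]; have := hinj _ _ (inA i) (inA j) E.
  by move/levy_of_atom_inj/(congr1 tag) => /= /val_inj.
move=> Y YA DY; apply: (denumerable_not_finite ZM DY).
have [m [y [Yy _ Sy]]] := denumerable_enum DY.
(* The atoms of the first [m] blocks. They cover [Y], because an atom of a later block is moved by
   the generator of that block. *)
pose F (t : {i : 'I_m & 'I_(nth_prime i)}) : M :=
  levy_of_atom (Tagged (fun n => 'I_(nth_prime n)) (tagged t)).
apply: (levy_finite (F := F)); first by case: DY.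
move=> z zY; have /HA/levy_atomP[[i a] E] := YA _ zY.
have [im|mi] := ltnP i m; first by exists (Tagged (fun i : 'I_m =>
    'I_(nth_prime i)) (a : 'I_(nth_prime (Ordinal im)))).
have [n En] := proj1 (Yy z) zY.
have := Sy n i mi; rewrite -En E levy_act_of_atom => /levy_of_atom_inj.
rewrite -[levy_perm i _]/(iter 1 (levy_perm i) _) iter_levy_perm => /eqP;
    rewrite eq_Tagged /= => /eqP/(congr1 val) /=.
have p1 := prime_gt1 (nth_prime_prime i).
(* The cyclic successor of [a] is never [a]: a wrap-around to 0 would force the prime to be 1, and
   otherwise the successor is [a.+1]. *)
have [E1|ne] := eqVneq a.+1 (nth_prime i).
  by rewrite E1 modnn => a0; move: p1; rewrite -E1 -a0.
rewrite modn_small; first by move/eqP; rewrite eqn_leq ltnn.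
by rewrite ltn_neqAle ne ltn_ord.
Qed.

Theorem proposition6p4 :
  (forall N : structure,
     ZFA N ->
     CMC N ->
     (forall n : N, in_omega n -> ge2 n -> C_omega n) ->
     ~ IDI N ->
     [/\ IQDI N,
         ~ IDI_F N
       & forall k : N, in_omega k -> ge2 k -> ~ IDI_k k])
  /\
  [/\ ZFA levy_model,
      CMC levy_model,
      forall n : levy_model, in_omega n -> ge2 n -> C_omega n
    & ~ IDI levy_model].
Proof.
split; last by split; [exact: levy_ZFA|exact: levy_CMC|exact: levy_C_omega|exact: levy_not_IDI].
move=> N HZ cmc Cn nIDI; have [X infX HX] := not_IDI_k HZ Cn nIDI.
split; first exact: CMC_IQDI HZ cmc.
  by move=> /(_ X infX)[n [nw _ [S HS]]]; exact: HX HS.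
by move=> k kw _ /(_ X infX)[S HS]; exact: HX HS.
Qed.
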